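(* Let $\vartheta_{\boldsymbol{P}}=(\vartheta,\boldsymbol{P})$ be a primitive and compatible random substitution on a finite alphabet $\mathcal{A}$, with Perron--Frobenius eigenvalue $\lambda$, normalised right Perron--Frobenius eigenvector $(R_a)_{a\in\mathcal{A}}$, and frequency measure $\mu_{\boldsymbol{P}}$. Then for every $q\ge 0$ the limits defining $\tau_{\mu_{\boldsymbol{P}}}(q)$ and $T_{\vartheta,\boldsymbol{P}}(q)$ exist (i.e. the limits inferior in their definitions are limits) and $\tau_{\mu_{\boldsymbol{P}}}(q)=T_{\vartheta,\boldsymbol{P}}(q)$. Moreover, for every $k\in\mathbb{N}$: 1. For all $0\le q\le 1$, $$\frac{1}{\lambda^k-1}\varphi_k(q)\le\tau_{\mu_{\boldsymbol{P}}}(q)\le\frac{1}{\lambda^k}\varphi_k(q),$$ and $(\lambda^{-k}\varphi_k(q))_{k=1}^\infty$ converges monotonically to $\tau_{\mu_{\boldsymbol{P}}}(q)$ from above. 2. For all $q\ge 1$, $$\frac{1}{\lambda^k}\varphi_k(q)\le\tau_{\mu_{\boldsymbol{P}}}(q)\le\frac{1}{\lambda^k-1}\varphi_k(q),$$ and $(\lambda^{-k}\varphi_k(q))_{k=1}^\infty$ converges monotonically to $\tau_{\mu_{\boldsymbol{P}}}(q)$ from below. 3. For all $q<0$, $$\frac{1}{\lambda^k-1}\varphi_k(q)\le\tau_{\mu_{\boldsymbol{P}}}(q).$$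
   Context: Random substitutions. Let $\mathcal{A}$ be a finite alphabet and $\mathcal{A}^+$ the set of non-empty finite words over $\mathcal{A}$; $|v|$ is the length of $v$ and $|v|_u$ the number of (possibly overlapping) occurrences of $u$ as a subword of $v$. A random substitution $\vartheta_{\boldsymbol{P}}=(\vartheta,\boldsymbol{P})$ consists of a set-valued substitution $\vartheta$ assigning to each letter $a$ a non-empty finite set $\vartheta(a)\subset\mathcal{A}^+$, together with, for each letter $a$, a probability vector on $\vartheta(a)$ with all entries strictly positive; $\mathbb{P}[\vartheta_{\boldsymbol{P}}(a)=s]$ denotes the probability of $s\in\vartheta(a)$. It acts on words by replacing each letter independently and concatenating; $\vartheta_{\boldsymbol{P}}^k(u)$ is the $k$-th step of the Markov chain on $\mathcal{A}^+$ started at $u$ (fresh independent choices at each step), and $\vartheta^k(u)$ is the set of words $v$ with $\mathbb{P}[\vartheta_{\boldsymbol{P}}^k(u)=v]>0$. The substitution matrix is $M_{b,a}=\mathbb{E}[|\vartheta_{\boldsymbol{P}}(a)|_b]$. $\vartheta_{\boldsymbol{P}}$ is primitive if some power of $M$ has all entries positive and the Perron--Frobenius eigenvalue $\lambda$ of $M$ satisfies $\lambda>1$. $\boldsymbol{R}=(R_a)_{a\in\mathcal{A}}$ is the positive right eigenvector, $M\boldsymbol{R}=\lambda\boldsymbol{R}$, with $\sum_aR_a=1$. $\vartheta_{\boldsymbol{P}}$ is compatible if for all $a,b\in\mathcal{A}$ and $u,v\in\vartheta(a)$, $|u|_b=|v|_b$. A word is legal if it is a subword of some element of $\vartheta^k(a)$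 for some $k\in\mathbb{N}$, $a\in\mathcal{A}$; $\mathcal{L}_\vartheta^n$ is the set of legal words of length $n$. The subshift $X_\vartheta\subset\mathcal{A}^{\mathbb{Z}}$ is the set of bi-infinite sequences all of whose finite subwords are legal. For legal $v$, $[v]=\{x\in X_\vartheta:x_i=v_i,\ 1\le i\le|v|\}$. The frequency measure $\mu_{\boldsymbol{P}}$ is the unique shift-invariant Borel probability measure on $X_\vartheta$ with $\mu_{\boldsymbol{P}}([v])=\lim_{k\to\infty}\mathbb{E}[|\vartheta_{\boldsymbol{P}}^k(a)|_v]/\mathbb{E}[|\vartheta_{\boldsymbol{P}}^k(a)|]$ for every legal $v$ (the limit exists and does not depend on $a\in\mathcal{A}$, by primitivity). $L^q$-spectra. For $q\in\mathbb{R}$, $$\tau_{\mu_{\boldsymbol{P}}}(q)=\liminf_{n\to\infty}-\frac1n\log\sum_{u\in\mathcal{L}_\vartheta^n}\mu_{\boldsymbol{P}}([u])^q .$$ For $k\in\mathbb{N}$ and $q\in\mathbb{R}$, $$\varphi_k(q)=-\sum_{a\in\mathcal{A}}R_a\log\Big(\sum_{s\in\vartheta^k(a)}\mathbb{P}[\vartheta_{\boldsymbol{P}}^k(a)=s]^q\Big),$$ and the inflation word $L^q$-spectrum is $T_{\vartheta,\boldsymbol{P}}(q)=\liminf_{k\to\infty}\lambda^{-k}\varphi_k(q)$. *)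

(* Defs.v *)
From HB Require Import structures.
From mathcomp Require Import all_boot all_order all_algebra finmap.
From mathcomp Require Import all_classical all_reals all_analysis.
From mathcomp Require Import complex.

Set Implicit Arguments.
Unset Strict Implicit.
Unset Printing Implicit Defensive.

Import Order.TTheory GRing.Theory Num.Theory.
Import numFieldNormedType.Exports.

Local Open Scope classical_set_scope.
Local Open Scope ring_scope.

(* The distinguished letter only records that the alphabet is non-empty: the
   library builds sigma-algebras on pointed types, here on A^Z. *)
#[short(type="alphabetType")]
HB.structure Definition Alphabet := {A of Finite A & Pointed A}.

(* [subst a] is the finite set vartheta(a); [prob a] is a probability vector
   indexed by that set. *)
Record random_substitution (R : realType) (A : finType) := RandomSubstitution {
  subst : A -> {fset seq A} ;
  prob : forall a : A, subst a -> R ;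
  subst_neq0 : forall a, subst a != fset0 ;
  subst_word_neq0 : forall a, [::] \notin subst a ;
  prob_gt0 : forall a (s : subst a), 0 < prob s ;
  prob_sum1 : forall a, \sum_(s : subst a) prob s = 1
}.

Section random_words.
Context {R : realType} {A : finType} (th : random_substitution R A).

(* P[theta_P(u) = v]: the image s of the first letter of u must be a prefix of
   v, and, independently, the rest of u is mapped to the rest of v. *)
Fixpoint step_prob (u v : seq A) : R :=
  if u is a :: u' then
    \sum_(s : subst th a | prefix (fsval s) v)
      prob s * step_prob u' (drop (size (fsval s)) v)
  else (v == [::])%:R.

(* P[theta_P^k(u) = v]. Only finitely many intermediate words w contribute. *)
Fixpoint iter_prob (k : nat) (u v : seq A) : R :=
  if k is k'.+1 then
    \sum_(w \in [set: seq A]) iter_prob k' u w * step_prob w v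
  else (v == u)%:R.

Definition iter_words (k : nat) (u : seq A) : set (seq A) :=
  [set v | 0 < iter_prob k u v].

(* E[f(theta_P^k(u))] *)
Definition iter_expect (k : nat) (u : seq A) (f : seq A -> R) : R :=
  \sum_(v \in iter_words k u) iter_prob k u v * f v.

End random_words.

(* |v|_u. For u empty the value is |v|, so that the frequency of the empty
   word below is 1. *)
Definition occ (A : eqType) (u v : seq A) : nat :=
  count (fun i => prefix u (drop i v)) (iota 0 (size v)).

(* Letters are identified with indices through [enum_rank] / [enum_val]. *)
Definition subst_matrix (R : realType) (A : finType)
    (th : random_substitution R A) : 'M[R]_#|A| :=
  \matrix_(b, a) iter_expect th 1 [:: enum_val a]
                   (fun v => (occ [:: enum_val b] v)%:R).

Definition perron_eigenvalue (R : realType) (n : nat) (M : 'M[R]_n) (lam : R) :=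
  eigenvalue M lam /\
  forall z : complex R, eigenvalue (map_mx (real_complex R) M) z ->
    Normc.normc z <= lam.

Definition perron_vector (R : realType) (n : nat) (M : 'M[R]_n) (lam : R)
    (r : 'cV[R]_n) :=
  [/\ M *m r = lam *: r, (forall i, 0 < r i 0) & \sum_i r i 0 = 1].

Section properties.
Context {R : realType} {A : finType} (th : random_substitution R A).

Definition primitive :=
  (exists2 n, (0 < n)%N & forall b a, 0 < (subst_matrix th ^+ n) b a) /\
  (exists2 lam, perron_eigenvalue (subst_matrix th) lam & 1 < lam).

Definition compatible :=
  forall (a b : A) (u v : seq A), u \in subst th a -> v \in subst th a ->
    occ [:: b] u = occ [:: b] v.

Definition legal (w : seq A) :=
  exists k a v, [/\ (0 < k)%N, iter_words th k [:: a] v & infix w v].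

End properties.

(* A^Z with the product topology *)
Definition biseq (A : Type) := {ptws int -> discrete_topology A}.

HB.instance Definition _ (A : choiceType) := Topological.on (biseq A).
HB.instance Definition _ (A : alphabetType) :=
  Pointed.copy (biseq A) (int -> A).

Notation borel_biseq A := (g_sigma_algebraType (@open (biseq A))).

Definition shift (A : Type) (x : biseq A) : biseq A := fun i => x (i + 1).

(* the word x_i x_(i+1) ... x_(i+n-1) *)
Definition window (A : Type) (x : biseq A) (i : int) (n : nat) : seq A :=
  [seq x (i + j%:Z) | j <- iota 0 n].

Section frequency_measure.
Context {R : realType} {A : alphabetType} (th : random_substitution R A).

Definition subshift : set (borel_biseq A) :=
  [set x | forall i n, legal th (window x i n)].

Definition cylinder (v : seq A) : set (borel_biseq A) :=
  subshift `&` [set x | window x 1 (size v) = v].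

(* A Borel measure on the closed set X is a Borel measure on A^Z giving full
   mass to X. *)
Definition frequency_measure (mu : probability (borel_biseq A) R) :=
  [/\ mu subshift = 1%E,
      (forall B : set (borel_biseq A),
         measurable B -> mu (@shift A @^-1` B) = mu B) &
      forall v a, legal th v ->
        (iter_expect th k [:: a] (fun w => (occ v w)%:R) /
         iter_expect th k [:: a] (fun w => (size w)%:R))%:E @[k --> \oo]
        --> mu (cylinder v)].

Definition Lq_term (mu : probability (borel_biseq A) R) (q : R) (n : nat)
  : \bar R :=
  (- n%:R^-1 * ln (\sum_(u : n.-tuple A | `[< legal th u >])
                     fine (mu (cylinder u)) `^ q))%:E.

Definition Lq_spectrum (mu : probability (borel_biseq A) R) (q : R) : \bar R :=
  limn_einf (Lq_term mu q).

End frequency_measure.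

Section inflation_word_spectrum.
Context {R : realType} {A : finType} (th : random_substitution R A).
Context (lam : R) (r : 'cV[R]_#|A|).

Definition phi (k : nat) (q : R) : R :=
  - \sum_(a : A) r (enum_rank a) 0 *
      ln (\sum_(s \in iter_words th k [:: a]) iter_prob th k [:: a] s `^ q).

Definition inflation_term (q : R) (k : nat) : \bar R :=
  (lam ^- k * phi k q)%:E.

Definition inflation_spectrum (q : R) : \bar R := limn_einf (inflation_term q).

End inflation_word_spectrum.

(* Main.v *)
Require Import Defs.
From mathcomp Require Import all_boot all_order all_algebra finmap.
From mathcomp Require Import all_classical all_reals all_analysis.
From mathcomp Require Import complex ring lra.

Set Implicit Arguments.
Unset Strict Implicit.
Unset Printing Implicit Defensive.

Import Order.TTheory GRing.Theory Num.Theory.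
Import numFieldNormedType.Exports.

Local Open Scope classical_set_scope.
Local Open Scope ring_scope.

(* Compatibility fixes the length and the letter counts of theta^k(u), so a word
   of theta^k(u) has a unique decomposition into images of the letters of u, and
   S_k(u) := sum_s P[theta_P^k(u) = s]^q is multiplicative in u.  Counting
   occurrences in theta^(m+k)(a) = theta^k(theta^m(a)) and letting m tend to
   infinity gives the renewal identity
     lam^k mu[u] = sum_v mu[v] sum_j P[u is read at position j of theta^k(v)],
   v ranging over legal words of a length p just large enough for theta^k(v) to
   cover u (so p ~ lam^-k |u|) and j over the image of the first letter of v.
   Put Z_n := sum_(|u| = n) mu[u]^q and take q-th powers in the identity, for
   q <= 1 (everything is reversed for q >= 1).  Subadditivity of x^q gives
   Z_n <= C Z_p max_v S_k(v), hence by recursion tau >= phi_k / (lam^k - 1);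
   concavity of x^q, for q >= 0, gives Z_n >= min_v S_k(interior of v), hence
   tau <= lam^-k phi_k.  Letter frequencies are uniform on legal words, which
   turns ln S_k(v) into -|v| phi_k + o(|v|).
   Concavity also makes lam^-k phi_k monotone, and the two bounds differ by a
   factor 1 - lam^-k, so both converge to tau. *)

(** * Words *)

Section words.
Context {A : finType}.
Implicit Types u v w s : seq A.

(** Plain sequences rather than tuples: a word of length m + n then splits by concatenation, with no
    cast between length-indexed types. *)
Fixpoint words (n : nat) : seq (seq A) :=
  if n is n'.+1 then [seq a :: w | a <- enum A, w <- words n'] else [:: [::]].

Lemma mem_words n s : (s \in words n) = (size s == n).
Proof.
elim: n s => [|n IHn] [|a s] //=.
- by apply/negbTE/negP => /allpairsP[[b w] [_ _]].
- rewrite eqSS -IHn; apply/allpairsP/idP => [[[b w] /= [_ wn [_ ->]]] //|sn].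
  by exists (a, s); rewrite mem_enum.
Qed.

Lemma words_uniq n : uniq (words n).
Proof.
elim: n => //= n IHn; apply: allpairs_uniq; rewrite ?enum_uniq // => -[a w] [b v].
by move=> _ _ /= [-> ->].
Qed.

Lemma size_words n s : s \in words n -> size s = n.
Proof. by rewrite mem_words => /eqP. Qed.

Lemma big_wordsD (V : nmodType) m n (F : seq A -> V) :
  \sum_(s <- words (m + n)) F s =
  \sum_(s <- words m) \sum_(t <- words n) F (s ++ t).
Proof.
elim: m F => [|m IHm] F; first by rewrite big_seq1.
rewrite addSn /= !big_allpairs_dep; apply: eq_bigr => a _.
by rewrite (IHm (fun w => F (a :: w))).
Qed.

Lemma big_tuple_words (V : nmodType) n (P : pred (seq A)) (F : seq A -> V) :
  \sum_(u : n.-tuple A | P u) F u = \sum_(u <- words n | P u) F u.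
Proof.
rewrite -[LHS](big_map (val : n.-tuple A -> _) P F).
apply: perm_big; apply: uniq_perm (words_uniq n) _ => [|s].
  by rewrite map_inj_uniq ?index_enum_uniq //; exact: val_inj.
rewrite mem_words; apply/mapP/idP => [[t _ ->]|sn]; first by rewrite size_tuple.
by exists (Tuple sn); rewrite ?mem_index_enum.
Qed.

Lemma big_words1 (V : nmodType) n t (F : seq A -> V) :
  \sum_(v <- words n | v == t) F v = if size t == n then F t else 0.
Proof.
rewrite -mem_words; have [tn|tn] := boolP (t \in words n).
  rewrite big_mkcond (bigD1_seq t) ?words_uniq //= eqxx big1 ?addr0 // => v.
  by move=> /negbTE ->.
by rewrite big_seq_cond big1 // => v /andP[vn /eqP vt]; rewrite -vt vn in tn.
Qed.

Lemma fsum_words (R : pzRingType) n (D : set (seq A)) (F : seq A -> R) :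
  (forall s, D s -> size s = n) -> (forall s, ~ D s -> F s = 0) ->
  \sum_(s \in D) F s = \sum_(s <- words n) F s.
Proof.
move=> Dn F0; apply: fsbig_fwiden (words_uniq n) _ => [s /Dn/eqP|s [_ /F0]] //.
by rewrite /= mem_words.
Qed.

(** Occurrences are sorted by starting position; one that starts in [s] may run into [t], so it is
    tested against [s ++ t]. *)
Lemma occ_cat u s t :
  occ u (s ++ t) =
  (\sum_(j < size s) prefix u (drop j (s ++ t)) + occ u t)%N.
Proof.
rewrite /occ size_cat iotaD count_cat [(0 + _)%N]addnC iotaDl count_map; congr addn.
  rewrite -sum1_count big_mkcond -[in LHS](subn0 (size s)) big_mkord.
  by apply: eq_bigr => i _; case: prefix.
by apply: eq_count => i /=; rewrite drop_cat ltnNge leq_addr /= addKn.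
Qed.

Lemma occ_nil s : occ [::] s = size s.
Proof.
by rewrite /occ (eq_count (a2 := predT)) ?count_predT ?size_iota // => i;
  exact: prefix0s.
Qed.

Lemma occ_letter b s : occ [:: b] s = count_mem b s.
Proof.
elim: s => // a s IHs; rewrite -(cat1s a s) occ_cat big_ord1 IHs /=.
by rewrite eq_sym prefix0s andbT.
Qed.

Lemma occ_eq0 u s : ~~ infix u s -> occ u s = 0%N.
Proof.
elim: s => // a s IHs; rewrite -(cat1s a s) occ_cat big_ord1 infix_consl negb_or.
by case/andP=> /negbTE -> /IHs ->.
Qed.

Lemma leq_occ u s : (occ u s <= size s)%N.
Proof. by rewrite /occ -{2}(size_iota 0 (size s)) count_size. Qed.

End words.

(** * Iterates of a compatible substitution *)

Section inflation.
Context {R : realType} {A : finType} (th : random_substitution R A).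
Context (compat : compatible th).
Implicit Types (u v w s t : seq A) (a b c : A).

Local Notation P := (iter_prob th).

Definition rep_word a : seq A := head [::] (enum_fset (subst th a)).

Definition rep_image u : seq A := flatten [seq rep_word a | a <- u].

(* Compatibility makes every realisation of theta^k(u) an anagram of the word
   [infl k u] obtained by always choosing the same images of letters. *)
Definition infl k u : seq A := iter k rep_image u.

Lemma rep_word_in a : rep_word a \in subst th a.
Proof.
have /fset0Pn[x xa] := subst_neq0 th a.
have : x \in enum_fset (subst th a) by exact: xa.
suff mem_rep (l : seq (seq A)) : l = enum_fset (subst th a) -> x \in l ->
    head [::] l \in subst th a.
  exact: mem_rep erefl.
case: l => // y l e _; suff : y \in enum_fset (subst th a) by [].
by rewrite -e mem_head.
Qed.

Lemma subst_perm a s : s \in subst th a -> perm_eq s (rep_word a).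
Proof.
move=> sa; apply/allP => b _ /=; apply/eqP.
by rewrite -!occ_letter; exact: compat sa (rep_word_in a).
Qed.

Lemma size_subst a s : s \in subst th a -> size s = size (rep_word a).
Proof. by move/subst_perm/perm_size. Qed.

Lemma rep_word_gt0 a : (0 < size (rep_word a))%N.
Proof.
rewrite lt0n size_eq0; apply/eqP => e; have := rep_word_in a.
by rewrite e (negbTE (subst_word_neq0 th a)).
Qed.

Lemma rep_image_cat u v : rep_image (u ++ v) = rep_image u ++ rep_image v.
Proof. by rewrite /rep_image map_cat flatten_cat. Qed.

Lemma rep_image1 a : rep_image [:: a] = rep_word a.
Proof. exact: cats0. Qed.

Lemma perm_rep_image u v : perm_eq u v -> perm_eq (rep_image u) (rep_image v).
Proof. by move=> uv; apply/perm_flatten/perm_map. Qed.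

Lemma infl_cat k u v : infl k (u ++ v) = infl k u ++ infl k v.
Proof. by elim: k => //= k ->; rewrite rep_image_cat. Qed.

Lemma infl_nil k : infl k [::] = [::].
Proof. by elim: k => //= k ->. Qed.

Lemma perm_infl k u v : perm_eq u v -> perm_eq (infl k u) (infl k v).
Proof. by move=> uv; elim: k => //= k; exact: perm_rep_image. Qed.

Lemma inflD m k u : infl (m + k) u = infl k (infl m u).
Proof. by rewrite /infl addnC iterD. Qed.

Lemma size_infl_cat k u v :
  size (infl k (u ++ v)) = (size (infl k u) + size (infl k v))%N.
Proof. by rewrite infl_cat size_cat. Qed.

Lemma size_infl_sum k u : size (infl k u) = (\sum_(c <- u) size (infl k [:: c]))%N.
Proof.
elim: u => [|c u IHu]; first by rewrite infl_nil big_nil.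
by rewrite -cat1s size_infl_cat IHu big_cons.
Qed.

Lemma size_rep_image u : (size u <= size (rep_image u))%N.
Proof.
elim: u => // a u IHu; rewrite -cat1s rep_image_cat rep_image1 !size_cat.
exact: leq_add (rep_word_gt0 a) IHu.
Qed.

Lemma size_infl_ge k u : (size u <= size (infl k u))%N.
Proof. by elim: k => //= k /leq_trans; apply; exact: size_rep_image. Qed.

Lemma infl1_gt0 k c : (0 < size (infl k [:: c]))%N.
Proof. exact: size_infl_ge k [:: c]. Qed.

(** * Transition probabilities of one step *)

Lemma step_prob_ge0 u v : 0 <= step_prob th u v.
Proof.
elim: u v => [|a u IHu] v /=; first by rewrite ler0n.
by apply: sumr_ge0 => s _; rewrite mulr_ge0 // ltW // prob_gt0.
Qed.

Lemma step_prob_perm u v : step_prob th u v != 0 -> perm_eq v (rep_image u).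
Proof.
elim: u v => [|a u IHu] v /=; first by case: (v =P [::]) => [->|] //; rewrite eqxx.
move=> /eqP nz; have [[s sv sn0]|none] := pselect
  (exists2 s : subst th a, prefix (fsval s) v &
     step_prob th u (drop (size (fsval s)) v) != 0); last first.
  exfalso; apply: nz; apply: big1 => s sv; apply/eqP; rewrite mulf_eq0.
  apply/orP; right; apply/negPn/negP => sn0; exact: none (ex_intro2 _ _ s sv sn0).
move: sv => /prefixP[t vE]; rewrite vE drop_size_cat // in sn0 *.
by apply: perm_cat; [apply: subst_perm; exact: valP|exact: IHu].
Qed.

(** All images of [u] have the length of [rep_image u], so the image of [u ++ v] can only be cut
    between [s] and [t], and the two pieces are independent. *)
Lemma step_prob_cat u v s t : size s = size (rep_image u) ->
  step_prob th (u ++ v) (s ++ t) = step_prob th u s * step_prob th v t.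
Proof.
elim: u s => [|a u IHu] s /=.
  by move=> /size0nil ->; rewrite eqxx mul1r.
rewrite size_cat => szs; rewrite mulr_suml.
have le_ws (x : subst th a) : (size (fsval x) <= size s)%N.
  by rewrite szs (size_subst (valP x)) leq_addr.
apply: eq_big => [x|x _].
  by rewrite !prefixE takel_cat.
rewrite -mulrA drop_cat; congr (_ * _).
have := le_ws x; rewrite leq_eqVlt => /predU1P[e|lt]; last first.
  by rewrite lt IHu // size_drop szs (size_subst (valP x)) addKn.
(* The image of the first letter fills [s]: the rest of [u] has an empty image, and the induction
   hypothesis is used at the empty word. *)
rewrite e ltnn subnn drop0 drop_size -(IHu [::]) //.
by apply/esym/eqP; rewrite -(eqn_add2l (size (rep_word a))) -szs -e addn0
  (size_subst (valP x)).
Qed.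

Lemma step_prob_rep_image u : 0 < step_prob th u (rep_image u).
Proof.
elim: u => [|a u IHu]; first exact: ltr01.
rewrite -(cat1s a) rep_image_cat step_prob_cat // mulr_gt0 //= rep_image1.
have xP := rep_word_in a; rewrite (bigD1 [` xP]%fset) //=; last first.
  by rewrite prefix_refl.
rewrite drop_size eqxx mulr1 ltr_pwDl ?prob_gt0 // sumr_ge0 // => y _.
by rewrite mulr_ge0 // ltW ?prob_gt0.
Qed.

Lemma step_prob_sum1 u :
  \sum_(v <- words (size (rep_image u))) step_prob th u v = 1.
Proof.
elim: u => [|a u IHu]; first by rewrite /= big_seq1.
rewrite -(cat1s a) rep_image_cat size_cat big_wordsD big_seq.
under eq_bigr => s /size_words ss.
  under eq_bigr do rewrite step_prob_cat //.
  rewrite -mulr_sumr IHu mulr1.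
  over.
rewrite -big_seq rep_image1 /=.
under eq_bigr do rewrite big_mkcond /=.
rewrite exchange_big /= -[RHS](prob_sum1 th a); apply: eq_bigr => x _.
have xs : fsval x \in words (size (rep_word a)).
  by rewrite mem_words (size_subst (valP x)).
rewrite (bigD1_seq (fsval x)) ?words_uniq //= prefix_refl drop_size eqxx mulr1.
rewrite big_seq_cond big1 ?addr0 // => v /andP[/size_words vn vx].
case: ifP => // /prefixP[t vE]; rewrite vE drop_size_cat //.
have : size v = size (fsval x) by rewrite vn (size_subst (valP x)).
rewrite {1}vE size_cat => /eqP; rewrite -[X in _ == X]addn0 eqn_add2l size_eq0.
by move=> /eqP t0; rewrite vE t0 cats0 eqxx in vx.
Qed.

(** * Transition probabilities of k steps *)

Lemma iter_prob_perm k u v : P k u v != 0 -> perm_eq v (infl k u).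
Proof.
elim: k v => [|k IHk] v /=; first by case: (v =P u) => [->|] //; rewrite eqxx.
move=> /eqP nz.
have [[w wP]|none] := pselect (exists w, P k u w * step_prob th w v != 0).
  move: wP; rewrite mulf_eq0 negb_or => /andP[/IHk uw /step_prob_perm wv].
  by apply: perm_trans wv _; exact: perm_rep_image.
exfalso; apply: nz; apply: fsbig1 => w _; apply/eqP/negPn/negP => wP.
by apply: none; exists w.
Qed.

Lemma iter_prob_size k u v : P k u v != 0 -> size v = size (infl k u).
Proof. by move/iter_prob_perm/perm_size. Qed.

(** Compatibility fixes the length of the intermediate words, which turns the finitely supported sum
    of the definition into a sum over a list. *)
Lemma iter_probS k u v :
  P k.+1 u v = \sum_(w <- words (size (infl k u))) P k u w * step_prob th w v.
Proof.
rewrite /= -(fsbig_widen [set w | P k u w != 0] setT) //; last first.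
  by move=> w [_ /negP/negPn/eqP /= ->]; rewrite mul0r.
apply: fsum_words => w; first exact: iter_prob_size.
by move=> /negP/negPn/eqP ->; rewrite mul0r.
Qed.

Lemma iter_prob0 u v : P 0 u v = (v == u)%:R.
Proof. by []. Qed.

Arguments iter_prob : simpl never.

Lemma iter_prob_ge0 k u v : 0 <= P k u v.
Proof.
elim: k v => [|k IHk] v; first exact: ler0n.
by rewrite iter_probS sumr_ge0 // => w _; rewrite mulr_ge0 // step_prob_ge0.
Qed.

Lemma iter_prob_infl k u : 0 < P k u (infl k u).
Proof.
elim: k => [|k IHk]; first by rewrite iter_prob0 eqxx ltr01.
rewrite iter_probS (bigD1_seq (infl k u)) ?words_uniq ?mem_words //=.
rewrite ltr_pwDl ?mulr_gt0 ?step_prob_rep_image // sumr_ge0 // => w _.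
by rewrite mulr_ge0 // ?iter_prob_ge0 ?step_prob_ge0.
Qed.

Lemma iter_prob_cat k u v s t : size s = size (infl k u) ->
  P k (u ++ v) (s ++ t) = P k u s * P k v t.
Proof.
elim: k s t => [|k IHk] s t ss.
  by rewrite !iter_prob0 eqseq_cat // -mulnb natrM.
rewrite !iter_probS infl_cat size_cat big_wordsD mulr_suml.
rewrite [LHS]big_seq [RHS]big_seq; apply: eq_bigr => w1 /size_words w1n.
rewrite mulr_sumr; apply: eq_bigr => w2 _; rewrite IHk //.
have [->|nz] := eqVneq (P k u w1) 0; first by rewrite !mul0r.
rewrite step_prob_cat; first by rewrite mulrACA.
by rewrite ss /=; apply/esym/perm_size/perm_rep_image/iter_prob_perm.
Qed.

(** The Chapman-Kolmogorov equation. The definition splits off the last step, hence the induction on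
    [k]. *)
Lemma iter_prob_comp m k u s :
  P (m + k) u s = \sum_(w <- words (size (infl m u))) P m u w * P k w s.
Proof.
elim: k s => [|k IHk] s.
  rewrite addn0; under eq_bigr => w _ do rewrite iter_prob0 mulr_natr mulrb eq_sym.
  rewrite -big_mkcond big_words1; case: eqP => // nz; apply/eqP/negPn/negP.
  by move=> /iter_prob_size.
rewrite addnS iter_probS; under eq_bigr do rewrite IHk mulr_suml.
rewrite exchange_big /=; apply: eq_bigr => w _.
have [P0|nz] := eqVneq (P m u w) 0.
  by rewrite P0 mul0r big1 // => t _; rewrite !mul0r.
under eq_bigr do rewrite -mulrA.
rewrite -mulr_sumr iter_probS; congr (_ * _).
by rewrite inflD (perm_size (perm_infl k (iter_prob_perm nz))).
Qed.

Lemma iter_prob_sum1 k u : \sum_(s <- words (size (infl k u))) P k u s = 1.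
Proof.
elim: k => [|k IHk].
  under eq_bigr => s _ do rewrite iter_prob0 mulrb.
  by rewrite -big_mkcond big_words1 eqxx.
under eq_bigr do rewrite iter_probS.
rewrite exchange_big /= -[RHS]IHk; apply: eq_bigr => w _.
have [->|nz] := eqVneq (P k u w) 0; first by rewrite big1 // => s _; rewrite mul0r.
rewrite -mulr_sumr.
have -> : size (rep_image (infl k u)) = size (rep_image w).
  by apply/esym/perm_size/perm_rep_image/iter_prob_perm.
by rewrite step_prob_sum1 mulr1.
Qed.

Lemma fsum_iter_words k u (F : seq A -> R) :
  \sum_(v \in iter_words th k u) F v =
  \sum_(v <- words (size (infl k u)) | P k u v != 0) F v.
Proof.
rewrite [RHS]bigfs ?words_uniq // => [|v /iter_prob_size].
  congr (\big[_/_]_(v \in _) _); apply/seteqP; split => v /=; first exact: lt0r_neq0.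
  by rewrite /iter_words /= lt0r iter_prob_ge0 andbT.
by move=> vn; rewrite mem_words vn eqxx.
Qed.

Lemma iter_expectE k u (F : seq A -> R) :
  iter_expect th k u F =
  \sum_(v <- words (size (infl k u))) P k u v * F v.
Proof.
rewrite /iter_expect fsum_iter_words big_mkcond; apply: eq_bigr => v _.
by case: eqVneq => //= ->; rewrite mul0r.
Qed.

End inflation.

(** * Sums of q-th powers *)

Section powers.
Context {R : realType}.
Implicit Types (x y q : R) (b : bool).

(* [rle true] is [<=] and [rle false] is [>=]: every estimate for q <= 1 holds
   reversed for q >= 1, and both are proved at once under [rle b q 1]. *)
Definition rle b x y := if b then x <= y else y <= x.

Lemma rle_refl b x : rle b x x.
Proof. by case: b => /=. Qed.

Lemma rle_trans b y x z : rle b x y -> rle b y z -> rle b x z.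
Proof. by case: b => /= xy yz; [exact: le_trans xy yz|exact: le_trans yz xy]. Qed.

Lemma rleD b x y z t : rle b x y -> rle b z t -> rle b (x + z) (y + t).
Proof. by case: b => /=; exact: lerD. Qed.

Lemma rle_pM b x y z : 0 <= z -> rle b x y -> rle b (z * x) (z * y).
Proof. by case: b => /= z0 xy; rewrite ler_wpM2l. Qed.

Lemma rleN b x y : rle b (- x) (- y) = rle b y x.
Proof. by case: b; rewrite /= lerN2. Qed.

Lemma rle_sum b (I : Type) (r : seq I) (C : pred I) (F G : I -> R) :
  (forall i, C i -> rle b (F i) (G i)) ->
  rle b (\sum_(i <- r | C i) F i) (\sum_(i <- r | C i) G i).
Proof. by case: b => /= FG; exact: ler_sum. Qed.

Lemma rle_ln b x y : 0 < x -> 0 < y -> rle b x y -> rle b (ln x) (ln y).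
Proof. by case: b => /= x0 y0; rewrite ler_ln ?posrE. Qed.

(* Unlike [powR], [pw q] vanishes at 0 also for q = 0, so that sums of q-th
   powers only count words of positive probability. *)
Definition pw q x : R := if x == 0 then 0 else x `^ q.

Lemma pw0 q : pw q 0 = 0.
Proof. by rewrite /pw eqxx. Qed.

Lemma pw1 q : pw q 1 = 1.
Proof. by rewrite /pw oner_eq0 powR1. Qed.

Lemma pw_gt0 q x : 0 < x -> 0 < pw q x.
Proof. by move=> x0; rewrite /pw gt_eqF // powR_gt0. Qed.

Lemma pw_ge0 q x : 0 <= pw q x.
Proof. by rewrite /pw; case: ifP => // _; exact: powR_ge0. Qed.

Lemma pwM q x y : 0 <= x -> 0 <= y -> pw q (x * y) = pw q x * pw q y.
Proof.
move=> x0 y0; rewrite /pw mulf_eq0.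
case: eqVneq => /= _; first by rewrite mul0r.
by case: eqVneq => /= _; [rewrite mulr0|exact: powRM].
Qed.

Lemma powR_wanti x y q : q <= 0 -> 0 < x -> x <= y -> y `^ q <= x `^ q.
Proof.
move=> q0 x0 xy; have y0 := lt_le_trans x0 xy; rewrite /powR !gt_eqF //.
by rewrite ler_expR ler_wnM2l // ler_ln ?posrE.
Qed.

(** Write z^q = z z^(q-1): the factor z^(q-1) is nonincreasing for q <= 1 and nondecreasing for q >=
    1, and it is compared at x + y with its values at x and y. *)
Lemma pwD b q x y : rle b q 1 -> 0 <= x -> 0 <= y ->
  rle b (pw q (x + y)) (pw q x + pw q y).
Proof.
move=> q1; rewrite le_eqVlt => /predU1P[<-|x0]; first by rewrite pw0 !add0r rle_refl.
rewrite le_eqVlt => /predU1P[<-|y0]; first by rewrite pw0 !addr0 rle_refl.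
have E z : 0 < z -> z `^ q = z * z `^ (q - 1).
  move=> z0; have := @powRD _ z 1 (q - 1); rewrite (gt_eqF z0) implybT.
  by move=> /(_ isT); rewrite powRr1 ?ltW // addrC subrK.
rewrite /pw !gt_eqF ?addr_gt0 // !E ?addr_gt0 // mulrDl.
have mono z : 0 < z -> z <= x + y -> rle b ((x + y) `^ (q - 1)) (z `^ (q - 1)).
  move=> z0 zxy; case: b q1 => /= q1.
    by rewrite powR_wanti // subr_le0.
  by rewrite ge0_ler_powR ?subr_ge0 // nnegrE ltW // addr_gt0.
by apply: rleD; apply: rle_pM (ltW _) (mono _ _ _) => //; rewrite ?lerDl ?lerDr ltW.
Qed.

Lemma pw_sum b q (I : Type) (r : seq I) (C : pred I) (F : I -> R) :
  rle b q 1 -> (forall i, 0 <= F i) ->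
  rle b (pw q (\sum_(i <- r | C i) F i)) (\sum_(i <- r | C i) pw q (F i)).
Proof.
move=> q1 F0; elim: r => [|i r IHr]; first by rewrite !big_nil pw0 rle_refl.
rewrite !big_cons; case: (C i) => //.
apply: rle_trans (pwD q1 (F0 i) _) _; first exact: sumr_ge0.
by apply: rleD => //; exact: rle_refl.
Qed.

(** The tangent of x^q at 1 lies above the graph for q <= 1 and below it for q >= 1. *)
Lemma pw_bernoulli b q x : rle b q 1 -> 0 <= q -> 0 <= x ->
  rle b (pw q x) (1 + q * (x - 1)).
Proof.
move=> + q0; rewrite le_eqVlt => + /predU1P[<-|x0].
  by rewrite pw0; case: b => /= q1; lra.
(* With l = ln t, the tangent of exp at p l bounds exp from below at l and at 0; averaging the two
   bounds with weights p and 1 - p cancels the terms in l. *)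
have concave (p t : R) : 0 <= p -> p <= 1 -> 0 < t -> t `^ p <= 1 + p * (t - 1).
  move=> p0 p1 t0; rewrite /powR gt_eqF //; set l := ln t.
  have tE : t = expR (p * l) * expR (l - p * l).
    by rewrite -expRD addrC subrK lnK.
  have oE : 1 = expR (p * l) * expR (- (p * l)) :> R by rewrite -expRD subrr expR0.
  have h1 : expR (p * l) * (1 + (l - p * l)) <= t.
    by rewrite [leRHS]tE ler_wpM2l ?expR_ge0 ?expR_ge1Dx.
  have h2 : expR (p * l) * (1 - p * l) <= 1.
    by rewrite [leRHS]oE ler_wpM2l ?expR_ge0 ?expR_ge1Dx.
  have p1' : 0 <= 1 - p by rewrite subr_ge0.
  have := lerD (ler_wpM2l p0 h1) (ler_wpM2l p1' h2).
  by rewrite -/l; lra.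
case: b => /= q1; rewrite /pw gt_eqF //; first exact: concave.
have [le0|gt0] := leP (1 + q * (x - 1)) 0; first exact: le_trans le0 (powR_ge0 _ _).
have qgt0 : 0 < q := lt_le_trans ltr01 q1.
(* For q >= 1 the concave case is applied with exponent 1/q at 1 + q (x - 1), then raised to the
   power q. *)
have := concave q^-1 _ _ _ gt0; rewrite invr_ge0 q0 invf_le1 // q1 => /(_ isT isT).
have -> : 1 + q^-1 * (1 + q * (x - 1) - 1) = x by field; rewrite gt_eqF.
move=> h.
rewrite (_ : 1 + q * (x - 1) = ((1 + q * (x - 1)) `^ q^-1) `^ q); last first.
  by rewrite -powRrM mulVf ?gt_eqF // powRr1 // ltW.
by rewrite ge0_ler_powR // nnegrE ?powR_ge0 // ltW.
Qed.

(** By homogeneity, divide by the weighted sum y and use the tangent at 1 for each x_i / y. The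
    total is 1 + (W - 1) (1 - q) with W the sum of the weights, and W <= 1 gives the last term the
    right sign in both cases. *)
Lemma pw_jensen b q (I : Type) (r : seq I) (w x : I -> R) :
  rle b q 1 -> 0 <= q -> (forall i, 0 <= w i) -> (forall i, 0 <= x i) ->
  \sum_(i <- r) w i <= 1 ->
  rle b (\sum_(i <- r) w i * pw q (x i)) (pw q (\sum_(i <- r) w i * x i)).
Proof.
move=> q1 q0 w0 x0 sw; set y := \sum_(i <- r) _ * x i.
have wx0 i : 0 <= w i * x i by rewrite mulr_ge0.
have : 0 <= y by apply: sumr_ge0.
rewrite le_eqVlt => /predU1P[y0|y0].
  suff -> : \sum_(i <- r) w i * pw q (x i) = 0 by rewrite -y0 pw0 rle_refl.
  move: y0; rewrite /y; elim: r {sw y} => [|i r IHr]; first by rewrite !big_nil.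
  rewrite !big_cons => /esym/eqP; rewrite paddr_eq0 ?sumr_ge0 // => /andP[/eqP wx /eqP].
  move=> /esym/IHr ->; rewrite addr0; move/eqP: wx; rewrite mulf_eq0.
  by case/orP => /eqP ->; rewrite ?pw0 ?mul0r ?mulr0.
have yE i : w i * pw q (x i) = pw q y * (w i * pw q (x i / y)).
  have {1}-> : x i = y * (x i / y) by rewrite mulrCA mulfV ?gt_eqF ?mulr1.
  by rewrite pwM ?divr_ge0 ?(ltW y0) // mulrCA.
under eq_bigr do rewrite yE.
rewrite -mulr_sumr -[X in rle _ _ X]mulr1; apply: rle_pM (pw_ge0 _ _) _.
have step i : rle b (w i * pw q (x i / y)) (w i * (1 + q * (x i / y - 1))).
  by apply: rle_pM => //; apply: pw_bernoulli => //; rewrite divr_ge0 // (ltW y0).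
apply: rle_trans (rle_sum _ (fun i _ => step i)) _.
have -> : \sum_(i <- r) w i * (1 + q * (x i / y - 1)) =
    (1 - q) * (\sum_(i <- r) w i) + q * (y / y).
  rewrite {1}/y mulr_suml !mulr_sumr -big_split /=; apply: eq_bigr => i _.
  by rewrite mulrBr mulr1 addrCA addrC mulrDr mulrBl mul1r; ring.
rewrite divff ?gt_eqF // mulr1; set W := \sum_(i <- r) w i.
have -> : (1 - q) * W + q = 1 + (W - 1) * (1 - q) by ring.
case: b q1 {step} => /= q1.
  by rewrite gerDl mulr_le0_ge0 ?subr_le0 ?subr_ge0.
by rewrite lerDl mulr_le0 ?subr_le0.
Qed.

(** Subadditivity (superadditivity for q >= 1) on each fibre of [f]: this compares a finite measure
    with its image under [f]. *)
Lemma pw_push b q (T U : eqType) (X : seq T) (Y : seq U) (f : T -> U)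
    (x : T -> R) :
  rle b q 1 -> uniq Y -> (forall s, 0 <= x s) ->
  (forall s, s \in X -> x s != 0 -> f s \in Y) ->
  rle b (\sum_(u <- Y) pw q (\sum_(s <- X | f s == u) x s))
        (\sum_(s <- X) pw q (x s)).
Proof.
move=> q1 uY x0 fY.
have -> : \sum_(s <- X) pw q (x s) =
    \sum_(u <- Y) \sum_(s <- X | f s == u) pw q (x s).
  under [RHS]eq_bigr do rewrite big_mkcond.
  rewrite exchange_big /= big_seq [RHS]big_seq; apply: eq_bigr => s sX.
  have [xs0|xsn0] := eqVneq (x s) 0.
    by rewrite xs0 pw0 big1 // => u _; case: ifP.
  rewrite (bigD1_seq (f s)) ?fY //= eqxx big1 ?addr0 // => u.
  by rewrite eq_sym => /negbTE ->.
by apply: rle_sum => u _; exact: pw_sum.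
Qed.

End powers.

(** * Inflation word sums and windows *)

Section inflation_sums.
Context {R : realType} {A : finType} (th : random_substitution R A).
Context (compat : compatible th).
Implicit Types (u v w s t x y z : seq A) (a c : A) (b : bool) (q : R).

Local Notation P := (iter_prob th).
Local Notation infl := (infl th).

(** This is S_k(u); with [pw] only realisations of positive probability count. *)
Definition infl_sum k q u : R :=
  \sum_(s <- words (size (infl k u))) pw q (P k u s).

Lemma infl_sum_gt0 k q u : 0 < infl_sum k q u.
Proof.
rewrite /infl_sum (bigD1_seq (infl k u)) ?words_uniq ?mem_words //=.
rewrite ltr_pwDl ?pw_gt0 ?(iter_prob_infl compat) //.
by apply: sumr_ge0 => s _; exact: pw_ge0.
Qed.

Lemma infl_sum_nil k q : infl_sum k q [::] = 1.
Proof.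
rewrite /infl_sum infl_nil /= big_seq1.
have -> : P k [::] [::] = 1 by
  have := iter_prob_sum1 compat k [::]; rewrite infl_nil /= big_seq1.
exact: pw1.
Qed.

Lemma infl_sum_cat k q u v :
  infl_sum k q (u ++ v) = infl_sum k q u * infl_sum k q v.
Proof.
rewrite /infl_sum size_infl_cat big_wordsD mulr_suml [LHS]big_seq [RHS]big_seq.
apply: eq_bigr => s /size_words ss; rewrite mulr_sumr; apply: eq_bigr => t _.
by rewrite iter_prob_cat // pwM ?iter_prob_ge0.
Qed.

(** Multiplicativity in logarithmic form: a sum over letters, to which uniform letter frequencies
    apply. *)
Lemma ln_infl_sum k q u :
  ln (infl_sum k q u) = \sum_(c <- u) ln (infl_sum k q [:: c]).
Proof.
elim: u => [|c u IHu]; first by rewrite infl_sum_nil ln1 big_nil.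
by rewrite -cat1s infl_sum_cat lnM ?posrE ?infl_sum_gt0 // IHu big_cons.
Qed.

(* the probability that u is read at positions j, ..., j + n - 1 of theta^k(v) *)
Definition window_prob k n v j u : R :=
  \sum_(s <- words (size (infl k v)) | take n (drop j s) == u) P k v s.

Lemma window_prob_ge0 k n v j u : 0 <= window_prob k n v j u.
Proof. by apply: sumr_ge0 => s _; exact: iter_prob_ge0. Qed.

(** The window is a function of the word theta^k(v), so its law is an image of the law of that
    word. *)
Lemma window_prob_covering b k q n v j : rle b q 1 ->
  (j + n <= size (infl k v))%N ->
  rle b (\sum_(u <- words n) pw q (window_prob k n v j u)) (infl_sum k q v).
Proof.
move=> q1 jn; apply: pw_push => //; first exact: words_uniq.
  by move=> s; exact: iter_prob_ge0.
move=> s /size_words ss _; rewrite mem_words size_take_min size_drop ss.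
by apply/eqP/minn_idPl; rewrite leq_subRL // (leq_trans _ jn) ?leq_addr.
Qed.

(** Conversely, a window that covers the image of [y] determines it, so the law of theta^k(y) is an
    image of the law of the window. *)
Lemma window_prob_interior b k q n x y z j : rle b q 1 ->
  (j <= size (infl k x))%N -> (size (infl k (x ++ y)) <= j + n)%N ->
  (j + n <= size (infl k (x ++ y ++ z)))%N ->
  rle b (infl_sum k q y)
        (\sum_(u <- words n) pw q (window_prob k n (x ++ y ++ z) j u)).
Proof.
move=> q1 jx xyn jn; set v := x ++ y ++ z.
(* [g] reads the image of [y] off the window: the window starts at [j], this image at
   [size (infl k x)]. *)
pose g u := take (size (infl k y)) (drop (size (infl k x) - j) u).
have gE (s1 s2 s3 : seq A) : size s1 = size (infl k x) ->
    size s2 = size (infl k y) -> g (take n (drop j (s1 ++ s2 ++ s3))) = s2.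
  move=> e1 e2; rewrite /g [take n _]take_drop drop_drop subnK //.
  rewrite size_infl_cat in xyn.
  have -> : take (n + j) (s1 ++ s2 ++ s3) = s1 ++ s2 ++ take (n + j - size (s1 ++ s2)) s3.
    by rewrite catA take_cat size_cat e1 e2 ltnNge [(n + j)%N]addnC xyn /= -catA.
  by rewrite drop_size_cat ?e1 // take_size_cat ?e2.
have marg t : t \in words (size (infl k y)) ->
    P k y t = \sum_(u <- words n | g u == t) window_prob k n v j u.
  move=> /size_words tn; rewrite /window_prob.
  under eq_bigr do rewrite big_mkcond.
  rewrite exchange_big /=.
  have -> : \sum_(s <- words (size (infl k v)))
      \sum_(u <- words n | g u == t) (if take n (drop j s) == u then P k v s else 0) =
      \sum_(s <- words (size (infl k v))) (g (take n (drop j s)) == t)%:R * P k v s.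
    rewrite [LHS]big_seq [RHS]big_seq; apply: eq_bigr => s /size_words ss.
    rewrite -big_mkcondr /=.
    have fs : take n (drop j s) \in words n.
      rewrite mem_words size_take_min size_drop ss.
      by apply/eqP/minn_idPl; rewrite leq_subRL // (leq_trans _ jn) ?leq_addr.
    rewrite big_mkcond (bigD1_seq (take n (drop j s))) ?words_uniq //= eqxx andbT.
    rewrite big1 ?addr0 => [|u]; first by rewrite mulr_natl mulrb.
    by rewrite eq_sym => /negbTE ->; rewrite andbF.
  rewrite /v size_infl_cat big_wordsD big_seq.
  under eq_bigr => s1 /size_words e1.
    rewrite size_infl_cat big_wordsD big_seq.
    under eq_bigr => s2 /size_words e2.
      under eq_bigr => s3 _ do
        rewrite gE // iter_prob_cat // iter_prob_cat // mulrA mulrA.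
      rewrite -mulr_sumr iter_prob_sum1 // mulr1.
      over.
    rewrite -big_seq (bigD1_seq t) ?mem_words ?tn ?words_uniq //= eqxx mul1r.
    rewrite big1 ?addr0; last by move=> s2 /negbTE ->; rewrite !mul0r.
    over.
  by rewrite -big_seq -mulr_suml iter_prob_sum1 // mul1r.
rewrite /infl_sum big_seq; under eq_bigr => t tn do rewrite (marg t tn).
rewrite -big_seq; apply: pw_push => //; first exact: words_uniq.
  by move=> u; exact: window_prob_ge0.
move=> u un /eqP nz; rewrite mem_words.
have [/hasP[s /size_words ss /eqP <-]|/hasPn none] :=
  boolP (has (fun s => take n (drop j s) == u) (words (size (infl k v)))).
  rewrite -(cat_take_drop (size (infl k x)) s).
  rewrite -(cat_take_drop (size (infl k y)) (drop (size (infl k x)) s)).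
  have ss' := ss; rewrite /v !size_infl_cat in ss'.
  rewrite gE ?size_take_min ?size_drop ss' ?addKn; first exact/eqP/minn_idPl/leq_addr.
    exact/minn_idPl/leq_addr.
  exact/minn_idPl/leq_addr.
exfalso; apply: nz; rewrite /window_prob big_seq_cond big1 // => s /andP[sn].
by rewrite (negbTE (none s sn)).
Qed.

(** Condition on w = theta^m(a): the law of theta^(m+k)(a) is a mixture of the laws of theta^k(w),
    and S_k(w) is the same for all these w, since they are anagrams. Concavity or convexity of x^q
    does the rest. *)
Lemma infl_sum_jensen b m k q a : rle b q 1 -> 0 <= q ->
  rle b (infl_sum k q (infl m [:: a])) (infl_sum (m + k) q [:: a]).
Proof.
move=> q1 q0; set n := size (infl (m + k) [:: a]).
have -> : infl_sum k q (infl m [:: a]) =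
    \sum_(s <- words n) \sum_(w <- words (size (infl m [:: a])))
       P m [:: a] w * pw q (P k w s).
  rewrite exchange_big /= -[LHS]mul1r -(iter_prob_sum1 compat m [:: a]) mulr_suml.
  apply: eq_bigr => w _; rewrite -mulr_sumr.
  have [->|nz] := eqVneq (P m [:: a] w) 0; first by rewrite !mul0r.
  have mw := iter_prob_perm compat nz.
  (* Through logarithms S_k is a sum over letters, hence invariant under permutation of the word. *)
  congr (_ * _); rewrite -[LHS]lnK ?posrE ?infl_sum_gt0 // ln_infl_sum.
  rewrite -(perm_big _ mw) -ln_infl_sum lnK ?posrE ?infl_sum_gt0 // /infl_sum.
  by rewrite (perm_size (perm_infl th k mw)) -inflD.
apply: rle_sum => s _; rewrite iter_prob_comp //.
apply: pw_jensen => // [w|w|]; try exact: iter_prob_ge0.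
by rewrite iter_prob_sum1.
Qed.

End inflation_sums.

(** * Counting occurrences in iterated images *)

Section renewal.
Context {R : realType} {A : finType} (th : random_substitution R A).
Context (compat : compatible th).
Implicit Types (u v w s t x y z : seq A) (a c : A) (b : bool) (q : R).

Local Notation P := (iter_prob th).
Local Notation infl := (infl th).

Definition mean_occ k w u : R :=
  \sum_(s <- words (size (infl k w))) P k w s * (occ u s)%:R.

Lemma mean_occE k w u : iter_expect th k w (fun s => (occ u s)%:R) = mean_occ k w u.
Proof. exact: iter_expectE. Qed.

Lemma mean_occ_ge0 k w u : 0 <= mean_occ k w u.
Proof. by apply: sumr_ge0 => s _; rewrite mulr_ge0 ?iter_prob_ge0. Qed.

Lemma mean_cst k w C : \sum_(s <- words (size (infl k w))) P k w s * C = C.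
Proof. by rewrite -mulr_suml iter_prob_sum1 // mul1r. Qed.

Lemma mean_occ_letter k w c : mean_occ k w [:: c] = (count_mem c (infl k w))%:R.
Proof.
rewrite -[RHS](mean_cst k w); apply: eq_bigr => s _.
have [->|nz] := eqVneq (P k w s) 0; first by rewrite !mul0r.
by rewrite occ_letter (permP (iter_prob_perm compat nz)).
Qed.

Lemma mean_occ_nil k w : mean_occ k w [::] = (size (infl k w))%:R.
Proof.
rewrite -[RHS](mean_cst k w) [LHS]big_seq [RHS]big_seq.
by apply: eq_bigr => s /size_words ss; rewrite occ_nil ss.
Qed.

Lemma iter_expect_size k w :
  iter_expect th k w (fun s => (size s)%:R) = (size (infl k w))%:R.
Proof.
rewrite -mean_occ_nil -mean_occE; congr iter_expect; apply/funext => s.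
by rewrite occ_nil.
Qed.

Lemma mean_occ_le k w u : mean_occ k w u <= (size (infl k w))%:R.
Proof.
rewrite -mean_occ_nil; apply: ler_sum => s _.
by rewrite ler_wpM2l ?iter_prob_ge0 // ler_nat occ_nil leq_occ.
Qed.

Lemma infix_legal v w : legal th w -> infix v w -> legal th v.
Proof.
move=> [k [a [s [k0 ks ws]]]] vw; exists k, a, s; split=> //.
exact: infix_trans vw ws.
Qed.

Lemma legal_iter k a s : (0 < k)%N -> P k [:: a] s != 0 -> legal th s.
Proof.
move=> k0 nz; exists k, a, s; split; rewrite ?infix_refl //.
by rewrite /iter_words /= lt0r nz iter_prob_ge0.
Qed.

Lemma mean_occ_illegal k a u : (0 < k)%N -> ~ legal th u -> mean_occ k [:: a] u = 0.
Proof.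
move=> k0 nl; apply: big1 => s _.
have [->|nz] := eqVneq (P k [:: a] s) 0; first by rewrite mul0r.
rewrite occ_eq0 ?mulr0 //; apply/negP => us; apply: nl.
exact: infix_legal (legal_iter k0 nz) us.
Qed.

(** Occurrences starting beyond the image of [c] lie in the image of [w] and are counted by its
    marginal law. *)
Lemma mean_occ_cons k c w u :
  mean_occ k (c :: w) u =
  \sum_(j < size (infl k [:: c]))
     (\sum_(s <- words (size (infl k (c :: w))) | prefix u (drop j s)) P k (c :: w) s)
  + mean_occ k w u.
Proof.
have shape : infl k (c :: w) = infl k [:: c] ++ infl k w by rewrite -infl_cat.
rewrite /mean_occ shape size_cat big_wordsD.
transitivity (\sum_(s <- words (size (infl k [:: c])))
    \sum_(t <- words (size (infl k w))) (P k [:: c] s * (P k w t * (occ u t)%:R) +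
    P k (c :: w) (s ++ t) * (\sum_(j < size (infl k [:: c])) prefix u (drop j (s ++ t)))%:R)).
  rewrite [LHS]big_seq [RHS]big_seq; apply: eq_bigr => s /size_words ss.
  apply: eq_bigr => t _; rewrite occ_cat ss natrD mulrDr addrC; congr (_ + _).
  by rewrite -cat1s iter_prob_cat // mulrA.
under eq_bigr do rewrite big_split /= -mulr_sumr.
rewrite big_split /= -mulr_suml iter_prob_sum1 // mul1r addrC; congr (_ + _).
rewrite -(big_wordsD _ _ (fun s => P k (c :: w) s *
  (\sum_(j < size (infl k [:: c])) prefix u (drop j s))%:R)).
under [RHS]eq_bigr do rewrite big_mkcond.
rewrite exchange_big /=; apply: eq_bigr => s _.
rewrite natr_sum mulr_sumr; apply: eq_bigr => j _.
by rewrite mulr_natr mulrb.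
Qed.

(** Blocks of [p] letters are long enough that a window of length [n] starting in the image of the
    first letter stays inside the image of the block. *)
Context (k n p L : nat).
Context (p_gt0 : (0 < p)%N).
Context (L_max : forall c, (size (infl k [:: c]) <= L)%N).
Context (p_large : forall v, legal th v -> size v = p ->
  (n <= size (infl k (behead v)))%N).

(* the expected number of occurrences of u in theta^k(v) that start inside the
   image of the first letter of v *)
Definition head_occ v u : R :=
  \sum_(j < size (infl k (take 1 v))) window_prob th k n v j u.

Lemma head_occ_ge0 v u : 0 <= head_occ v u.
Proof. by apply: sumr_ge0 => j _; exact: window_prob_ge0. Qed.

(** Main term of the renewal identity for a fixed [w]: every position of [w] at which a full block
    [v] starts contributes [head_occ v u]. *)
Let head_sum w u : R := \sum_(v <- words p) (occ v w)%:R * head_occ v u.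

Lemma head_sum_cons c w u :
  head_sum (c :: w) u =
  (if (p <= (size w).+1)%N then head_occ (take p (c :: w)) u else 0) + head_sum w u.
Proof.
rewrite /head_sum.
under eq_bigr => v _ do
  rewrite -(cat1s c) occ_cat big_ord1 drop0 natrD mulrDl.
rewrite big_split; congr (_ + _).
transitivity (\sum_(v <- words p | v == take p (c :: w)) head_occ v u).
  rewrite [RHS]big_mkcond [LHS]big_seq [RHS]big_seq; apply: eq_bigr => v /size_words vp.
  by rewrite prefixE vp eq_sym mulr_natl mulrb.
rewrite big_words1 size_take_min /=; case: leqP => h.
  by rewrite eqxx.
by rewrite ltn_eqF.
Qed.

(** Induction on [w]: removing the first letter removes the same term from both sides while a full
    block starts there, and the final letters, where none does, cost at most [L] each. *)
Lemma mean_occ_head_sum w u : legal th w -> size u = n ->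
  head_sum w u <= mean_occ k w u <= head_sum w u + (minn (size w) p * L)%:R.
Proof.
move=> + un; elim: w => [|c w IHw] lw.
  rewrite min0n mul0n /head_sum big1 => [|v _]; last by rewrite /occ mul0r.
  by rewrite mean_occ_ge0 addr0 (le_trans (mean_occ_le _ _ _)) // infl_nil.
have {IHw} /andP[IH1 IH2] : head_sum w u <= mean_occ k w u <=
    head_sum w u + (minn (size w) p * L)%:R.
  by apply: IHw; apply: infix_legal lw _; exact: infix_cons.
rewrite head_sum_cons mean_occ_cons; case: ifP => pw'.
  set x := (X in X + mean_occ _ _ _).
  (* By [p_large] the window ends inside the image of the first [p] letters; the image of the
     remaining letters sums out to 1. *)
  have -> : x = head_occ (take p (c :: w)) u.
    rewrite /x /head_occ take_takel //= take0.
    have := esym (cat_take_drop p (c :: w)).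
    set v := take p (c :: w) => wE; rewrite wE.
    apply: eq_bigr => j _.
    have lv : legal th v.
      by apply: infix_legal lw _; rewrite prefixW // prefix_take.
    have vp : size v = p by rewrite /v size_takel.
    have vE : v = c :: behead v by rewrite /v; case: (p) p_gt0.
    have vsz : size (infl k v) = (size (infl k [:: c]) + size (infl k (behead v)))%N.
      by rewrite {1}vE -size_infl_cat.
    rewrite size_infl_cat big_mkcond big_wordsD /window_prob [RHS]big_mkcond.
    rewrite [LHS]big_seq [RHS]big_seq; apply: eq_bigr => s /size_words ss.
    have le_n : (n <= size (drop j s))%N.
      rewrite size_drop ss vsz.
      rewrite leq_subRL; last exact: leq_trans (ltnW (ltn_ord j)) (leq_addr _ _).
      by apply: leq_add (ltnW (ltn_ord j)) _; exact: p_large.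
    have js : (j < size s)%N.
      by rewrite ss vsz (leq_trans (ltn_ord j)) // leq_addr.
    under eq_bigr => t _ do
      rewrite drop_cat js prefixE un takel_cat // iter_prob_cat //.
    case: ifP => _; last by rewrite big1.
    by rewrite -mulr_sumr iter_prob_sum1 // mulr1.
  rewrite lerD2l IH1 /= -addrA lerD2l (le_trans IH2) // lerD2l ler_nat leq_mul2r.
  by apply/orP; right; rewrite leq_min geq_minr andbT (leq_trans (geq_minl _ _)).
(* Fewer than [p] letters are left: each of the at most [L] starting positions in the image of [c]
   counts at most once. *)
rewrite add0r; apply/andP; split.
  rewrite (le_trans IH1) // lerDr sumr_ge0 // => j _.
  by apply: sumr_ge0 => s _; exact: iter_prob_ge0.
have -> : minn (size (c :: w)) p = (minn (size w) p).+1.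
  by move/negbT: pw'; rewrite -ltnNge /= => h; rewrite !(minn_idPl _) // ltnW // ltnW.
rewrite mulSn natrD addrCA; apply: lerD IH2.
apply: (@le_trans _ _ (\sum_(j < size (infl k [:: c])) 1)).
  apply: ler_sum => j _; rewrite -(iter_prob_sum1 compat k (c :: w)).
  by rewrite big_mkcond; apply: ler_sum => s _; case: ifP => // _; exact: iter_prob_ge0.
by rewrite sumr_const card_ord ler_nat.
Qed.

(** Average the previous estimate over w = theta^m(a); [0 < m] makes every such w legal. *)
Lemma mean_occ_renewal m a u : (0 < m)%N -> size u = n ->
  `|mean_occ (m + k) [:: a] u -
    \sum_(v <- words p) mean_occ m [:: a] v * head_occ v u| <= (p * L)%:R.
Proof.
move=> m0 un.
have -> : mean_occ (m + k) [:: a] u = \sum_(w <- words (size (infl m [:: a])))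
    P m [:: a] w * mean_occ k w u.
  rewrite /mean_occ; under eq_bigr do rewrite iter_prob_comp // mulr_suml.
  rewrite exchange_big /=; apply: eq_bigr => w _.
  have [->|nz] := eqVneq (P m [:: a] w) 0.
    by rewrite mul0r big1 // => s _; rewrite !mul0r.
  rewrite inflD -(perm_size (perm_infl th k (iter_prob_perm compat nz))) mulr_sumr.
  by apply: eq_bigr => s _; rewrite mulrA.
have -> : \sum_(v <- words p) mean_occ m [:: a] v * head_occ v u =
    \sum_(w <- words (size (infl m [:: a]))) P m [:: a] w * head_sum w u.
  under eq_bigr do rewrite /mean_occ mulr_suml.
  rewrite exchange_big /=; apply: eq_bigr => w _; rewrite mulr_sumr.
  by apply: eq_bigr => v _; rewrite mulrA.
rewrite -sumrB (le_trans (ler_norm_sum _ _ _)) //.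
rewrite -[leRHS](mean_cst m [:: a]).
apply: ler_sum => w _; rewrite -mulrBr normrM ger0_norm ?iter_prob_ge0 //.
have [->|nz] := eqVneq (P m [:: a] w) 0; first by rewrite !mul0r.
rewrite ler_wpM2l ?iter_prob_ge0 //.
have /andP[h1 h2] := mean_occ_head_sum (legal_iter m0 nz) un.
rewrite ger0_norm ?subr_ge0 // lerBlDl (le_trans h2) // lerD2l ler_nat leq_mul2r.
by rewrite geq_minr orbT.
Qed.

End renewal.

(** * The renewal identity *)

Lemma cvg_sum_seq (R : realType) (I : Type) (r : seq I) (f : nat -> I -> R)
    (l : I -> R) :
  (forall i, f k i @[k --> \oo] --> l i) ->
  \sum_(i <- r) f k i @[k --> \oo] --> \sum_(i <- r) l i.
Proof.
move=> fl; elim: r => [|i r IHr].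
  by rewrite big_nil; under eq_fun do rewrite big_nil; exact: cvg_cst.
rewrite big_cons; under eq_fun do rewrite big_cons.
by apply: cvgD => //; exact: fl.
Qed.

(* The part of the hypotheses of the theorem that the proof uses: [wt] is the
   right Perron vector and [m v] the measure of the cylinder of v, read as 0
   when v is not legal. *)
Record frequency_data (R : realType) (A : finType) (th : random_substitution R A)
    (lam : R) (wt : A -> R) (m : seq A -> R) : Prop := FrequencyData {
  fd_compat : compatible th ;
  fd_lam_gt1 : 1 < lam ;
  fd_wt_gt0 : forall c, 0 < wt c ;
  fd_wt_sum1 : \sum_c wt c = 1 ;
  fd_wt_eigen : forall G : A -> R,
    \sum_a wt a * (\sum_(c <- rep_word th a) G c) = lam * \sum_c wt c * G c ;
  fd_lim : forall v a, legal th v ->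
    mean_occ th k [:: a] v / (size (infl th k [:: a]))%:R @[k --> \oo] --> m v ;
  fd_illegal : forall v, ~ legal th v -> m v = 0
}.

Section frequencies.
Context {R : realType} {A : finType} {th : random_substitution R A}.
Context {lam : R} {wt : A -> R} {m : seq A -> R}.
Context (fd : frequency_data th lam wt m).
Implicit Types (u v w s t x y z : seq A) (a c : A) (q : R).

Local Notation P := (iter_prob th).
Local Notation infl := (infl th).

Let compat := fd_compat fd.
Let lam_gt1 := fd_lam_gt1 fd.
Let wt_gt0 := fd_wt_gt0 fd.
Let wt_sum1 := fd_wt_sum1 fd.
Let wt_eigen := fd_wt_eigen fd.
Let m_lim := fd_lim fd.
Let m_illegal := fd_illegal fd.
Let lam_gt0 : 0 < lam := lt_trans ltr01 lam_gt1.

Lemma wt_infl k (G : A -> R) :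
  \sum_a wt a * (\sum_(c <- infl k [:: a]) G c) = lam ^+ k * \sum_c wt c * G c.
Proof.
elim: k G => [|k IHk] G.
  by rewrite mul1r; apply: eq_bigr => a _; rewrite big_seq1.
have E w : \sum_(c <- rep_image th w) G c =
    \sum_(a <- w) \sum_(c <- rep_word th a) G c.
  elim: w => [|a w IHw]; first by rewrite !big_nil.
  by rewrite -(cat1s a) rep_image_cat rep_image1 big_cat IHw big_cons.
under eq_bigr do rewrite E.
by rewrite IHk wt_eigen mulrA -exprSr.
Qed.

Lemma wt_size_infl k : \sum_a wt a * (size (infl k [:: a]))%:R = lam ^+ k.
Proof.
under eq_bigr do rewrite -sum1_size natr_sum.
by rewrite wt_infl; under eq_bigr do rewrite mulr1; rewrite wt_sum1 mulr1.
Qed.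

(** If [c] occurred in no image of a letter, the eigenvector equation tested on the indicator of [c]
    would give lam wt(c) = 0. *)
Lemma legal_letter c : legal th [:: c].
Proof.
have [[a ca]|none] := pselect (exists a, c \in rep_word th a); last first.
  have := wt_eigen (fun b => (b == c)%:R); rewrite big1 => [/esym/eqP|a _].
    rewrite (bigD1 c) //= eqxx mulr1 big1 ?addr0 => [|b /negbTE ->]; last first.
      by rewrite mulr0.
    by rewrite mulf_eq0 !gt_eqF.
  rewrite big1_seq ?mulr0 // => b /andP[_ ba]; case: eqP => // bc.
  by exfalso; apply: none; exists a; rewrite -bc.
apply: (@infix_legal _ _ _ _ (infl 1 [:: a])); last by rewrite infix1s /= rep_image1.
by apply: (legal_iter compat (k := 1) (a := a)) => //; rewrite gt_eqF // iter_prob_infl.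
Qed.

(** Averaging over the starting letter with weights [wt] makes the expected length exactly lam^k, a
    normalisation independent of the letter. *)
Let freq k v : R := lam ^- k * \sum_a wt a * mean_occ th k [:: a] v.

(** [freq k v] is a convex combination of the ratios of [fd_lim], which converge uniformly over the
    finite alphabet. *)
Let freq_cvg v : freq k v @[k --> \oo] --> m v.
Proof.
have [lv|nlv] := pselect (legal th v); last first.
  rewrite m_illegal //; apply: cvg_near_cst; near=> k.
  rewrite /freq big1 ?mulr0 // => a _; rewrite (mean_occ_illegal compat) ?mulr0 //.
  by near: k; exact: nbhs_infty_gt.
apply/cvgrPdist_le => e e0.
have near_all : \forall k \near \oo, forall a,
    `|m v - mean_occ th k [:: a] v / (size (infl k [:: a]))%:R| <= e.
  apply: filter_forall => a; exact: (cvgrPdist_le _ _).1 (@m_lim v a lv) e e0.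
near=> k; have hk : forall a,
    `|m v - mean_occ th k [:: a] v / (size (infl k [:: a]))%:R| <= e.
  by near: k.
have lk : 0 < lam ^+ k by rewrite exprn_gt0.
rewrite -(ler_pM2l lk) -[X in X * `|_|](ger0_norm (ltW lk)) -normrM /freq mulrBr.
rewrite mulrA divff ?gt_eqF // mul1r -{1}wt_size_infl mulr_suml -sumrB.
rewrite (le_trans (ler_norm_sum _ _ _)) // -{1}wt_size_infl mulr_suml.
apply: ler_sum => a _; rewrite -!mulrA -mulrBr normrM (ger0_norm (ltW (wt_gt0 a))).
rewrite ler_pM2l //.
have sz : 0 < (size (infl k [:: a]))%:R :> R by rewrite ltr0n infl1_gt0.
have -> : (size (infl k [:: a]))%:R * m v - mean_occ th k [:: a] v =
  (size (infl k [:: a]))%:R * (m v - mean_occ th k [:: a] v / (size (infl k [:: a]))%:R).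
  by field; rewrite gt_eqF.
by rewrite normrM (ger0_norm (ltW sz)) ler_pM2l.
Unshelve. all: by end_near. Qed.

Lemma m_ge0 v : 0 <= m v.
Proof.
apply: (cvgr_to_ge (@freq_cvg v)); near=> k.
rewrite mulr_ge0 // ?invr_ge0 ?exprn_ge0 // ?(ltW lam_gt0) //.
by apply: sumr_ge0 => a _; rewrite mulr_ge0 ?mean_occ_ge0 ?(ltW (wt_gt0 a)).
Unshelve. all: by end_near. Qed.

Lemma m_nil : m [::] = 1.
Proof.
apply: (cvg_unique (@Rhausdorff R) (@freq_cvg [::])); apply: cvg_near_cst; near=> k.
rewrite /freq; under eq_bigr do rewrite mean_occ_nil //.
by rewrite wt_size_infl mulVf // gt_eqF // exprn_gt0.
Unshelve. all: by end_near. Qed.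

Lemma m_letter c : m [:: c] = wt c.
Proof.
apply: (cvg_unique (@Rhausdorff R) (@freq_cvg [:: c])); apply: cvg_near_cst; near=> k.
rewrite /freq; under eq_bigr => a _ do
  rewrite mean_occ_letter // -sum1_count natr_sum big_mkcond.
rewrite (wt_infl k (fun b => if b == c then 1 else 0)) mulrA mulVf ?mul1r; last first.
  by rewrite gt_eqF // exprn_gt0.
rewrite (bigD1 c) //= eqxx mulr1 big1 ?addr0 // => b /negbTE ->.
by rewrite mulr0.
Unshelve. all: by end_near. Qed.

(** Averaged with [wt] and divided by lam^i, the bounded error of [mean_occ_renewal] vanishes as i
    grows, while both main terms converge by [freq_cvg]. *)
Lemma m_renewal k n p u : (0 < p)%N -> size u = n ->
  (forall v, legal th v -> size v = p -> (n <= size (infl k (behead v)))%N) ->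
  lam ^+ k * m u = \sum_(v <- words p) m v * head_occ th k n v u.
Proof.
move=> p0 un p_large; pose L := (\max_c size (infl k [:: c]))%N.
have L_max c : (size (infl k [:: c]) <= L)%N by exact: leq_bigmax.
pose d i := lam ^+ k * freq (i + k) u - \sum_(v <- words p) freq i v * head_occ th k n v u.
have d_cvg : d i @[i --> \oo] --> lam ^+ k * m u - \sum_(v <- words p) m v * head_occ th k n v u.
  apply: cvgB.
    apply: cvgM; first exact: cvg_cst.
    by have := @freq_cvg u; rewrite -(cvg_shiftn k).
  by apply: cvg_sum_seq => v; apply: cvgM; [exact: freq_cvg|exact: cvg_cst].
have d_bound i : (0 < i)%N -> `|d i| <= lam^-1 ^+ i * (p * L)%:R.
  move=> i0; have li : 0 < lam ^+ i by rewrite exprn_gt0.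
  have lk : 0 < lam ^+ k by rewrite exprn_gt0.
  have -> : d i = lam^-1 ^+ i * \sum_a wt a * (mean_occ th (i + k) [:: a] u -
      \sum_(v <- words p) mean_occ th i [:: a] v * head_occ th k n v u).
    under eq_bigr do rewrite mulrBr.
    rewrite sumrB mulrBr /d /freq exprVn exprD; congr (_ - _).
      set X := \sum_a _; move: (lam ^+ i) (lam ^+ k) li lk => x y x0 y0.
      by field; rewrite !gt_eqF.
    under eq_bigr do rewrite -mulrA mulr_suml.
    rewrite -mulr_sumr exchange_big /=; congr (_ * _); apply: eq_bigr => a _.
    by rewrite mulr_sumr; apply: eq_bigr => v _; rewrite mulrA.
  have lVi : 0 <= lam^-1 ^+ i by rewrite exprn_ge0 // invr_ge0 ltW.
  rewrite normrM (ger0_norm lVi) ler_wpM2l //.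
  rewrite (le_trans (ler_norm_sum _ _ _)) // -[leRHS]mul1r -[X in _ <= X * _]wt_sum1 mulr_suml.
  apply: ler_sum => a _; rewrite normrM (ger0_norm (ltW (wt_gt0 a))) ler_pM2l //.
  exact: (mean_occ_renewal compat p0 L_max p_large).
have d0 : d i @[i --> \oo] --> 0.
  apply: norm_cvg0; apply: (@squeeze_cvgr _ _ _ _ (fun=> 0) (fun i => lam^-1 ^+ i * (p * L)%:R)).
  - near=> i; rewrite normr_ge0 d_bound //; near: i; exact: nbhs_infty_gt.
  - exact: cvg_cst.
  - rewrite -[X in _ --> X](mul0r (p * L)%:R); apply: cvgM; last exact: cvg_cst.
    by apply: cvg_expr; rewrite ger0_norm ?invr_ge0 ?ltW // invf_lt1.
by apply/eqP; rewrite -subr_eq0; apply/eqP; exact: (cvg_unique (@Rhausdorff R) d_cvg d0).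
Unshelve. all: by end_near. Qed.

End frequencies.

(** * Letter frequencies of legal words *)

Section frequency_consequences.
Context {R : realType} {A : finType} {th : random_substitution R A}.
Context {lam : R} {wt : A -> R} {m : seq A -> R}.
Context (fd : frequency_data th lam wt m).
Implicit Types (u v w s t x y z : seq A) (a c : A) (q : R).

Local Notation P := (iter_prob th).
Local Notation infl := (infl th).

Let compat := fd_compat fd.

Lemma window_prob_nil k v j : window_prob th k 0 v j [::] = 1.
Proof.
rewrite /window_prob -[RHS](iter_prob_sum1 compat k v).
by apply: eq_bigl => s; rewrite take0.
Qed.

Lemma head_occ_nil k v : head_occ th k 0 v [::] = (size (infl k (take 1 v)))%:R.
Proof.
rewrite /head_occ; under eq_bigr do rewrite window_prob_nil.
by rewrite sumr_const card_ord.
Qed.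

(** The renewal identity for the empty word, which occurs at every position. *)
Lemma m_head_size k p : (0 < p)%N ->
  \sum_(v <- words p) m v * (size (infl k (take 1 v)))%:R = lam ^+ k.
Proof.
move=> p0; rewrite -[RHS]mulr1 -[X in _ = _ * X](m_nil fd) (m_renewal fd (n := 0) (p := p)) //.
by apply: eq_bigr => v _; rewrite head_occ_nil.
Qed.

Lemma m_sum1 p : \sum_(v <- words p) m v = 1.
Proof.
case: p => [|p]; first by rewrite big_seq1 (m_nil fd).
rewrite -[RHS](expr0 lam) -(m_head_size 0 (ltn0Sn p)) [LHS]big_seq [RHS]big_seq.
by apply: eq_bigr => -[|c v] /size_words // _; rewrite /= take0 mulr1.
Qed.

(** The renewal identity with k = 0 writes wt(c) > 0 as the sum of the masses of the blocks starting
    with [c]. *)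
Lemma m_head c p : (1 < p)%N -> exists2 v, size (c :: v) = p & 0 < m (c :: v).
Proof.
move=> p1; have p0 := ltnW p1.
have ren : lam ^+ 0 * m [:: c] = \sum_(v <- words p) m v * head_occ th 0 1 v [:: c].
  apply: (m_renewal fd) => // v _ vp; rewrite size_behead vp.
  by rewrite -subn1 subn_gt0.
have [//|none] := pselect (exists2 v, size (c :: v) = p & 0 < m (c :: v)).
have := fd_wt_gt0 fd c; rewrite -(m_letter fd) -[X in 0 < X]mul1r -(expr0 lam) ren.
rewrite big_seq big1 ?ltxx // => -[|d v] /size_words vp; first by rewrite -vp in p0.
have [dc|dc] := eqVneq d c.
  have -> : m (d :: v) = 0; last by rewrite mul0r.
  apply/eqP; rewrite eq_le (m_ge0 fd) andbT leNgt; apply/negP => mv.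
  by apply: none; exists v; rewrite -dc.
rewrite /head_occ big1 ?mulr0 // => j _.
rewrite /window_prob big1 // => s; rewrite iter_prob0.
have -> : j = 0%N :> nat by case: j => j /=; rewrite take0 ltnS leqn0 => /eqP.
case: (s =P d :: v) => // ->; rewrite drop0 /= take0 => /eqP[e].
by rewrite e eqxx in dc.
Qed.

(** If [u] occurs in a realisation of theta^K(c), a block of positive mass starting with [c]
    contributes a positive term to the renewal identity. *)
Lemma m_gt0 u : legal th u -> 0 < m u.
Proof.
have [->|u0] := eqVneq u [::]; first by rewrite (m_nil fd).
move=> [K [c [s [K0 Ks /infixP[x [y sE]]]]]].
(* Length n + 2 meets the bound of [m_head] and leaves n + 1 letters after the first, whose image
   has at least n letters. *)
pose n := size u; have [v vp mv] := m_head c (isT : (1 < n.+2)%N).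
have lamK : 0 < lam ^+ K by rewrite exprn_gt0 // (lt_trans ltr01 (fd_lam_gt1 fd)).
rewrite -(pmulr_rgt0 _ lamK) (m_renewal fd (n := n) (p := n.+2)) //; last first.
  move=> w _ wn; apply: leq_trans (size_infl_ge th K _).
  by rewrite size_behead wn.
rewrite (bigD1_seq (c :: v)) ?mem_words ?vp ?words_uniq //=.
rewrite ltr_pwDl //; last first.
  by apply: sumr_ge0 => w _; rewrite mulr_ge0 ?(m_ge0 fd) ?head_occ_ge0.
rewrite mulr_gt0 // /head_occ /= take0.
have ss : size s = size (infl K [:: c]).
  by apply: (iter_prob_size compat); rewrite gt_eqF.
have xs : (size x < size (infl K [:: c]))%N.
  by rewrite -ss sE !size_cat -[X in (X < _)%N]addn0 ltn_add2l ltn_addr // lt0n size_eq0.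
rewrite (bigD1 (Ordinal xs)) //= ltr_pwDl //; last first.
  by apply: sumr_ge0 => j _; exact: window_prob_ge0.
rewrite /window_prob big_mkcond (bigD1_seq (s ++ infl K v)) ?words_uniq //=; last first.
  by rewrite mem_words size_cat ss -size_infl_cat.
have -> : take n (drop (size x) (s ++ infl K v)) = u.
  by rewrite sE -!catA drop_size_cat // take_size_cat.
rewrite eqxx ltr_pwDl //; last first.
  by apply: sumr_ge0 => t _; case: ifP => // _; exact: iter_prob_ge0.
by rewrite -cat1s (iter_prob_cat compat) // mulr_gt0 // iter_prob_infl.
Qed.

Lemma count_sum (g : A -> R) s :
  \sum_(c <- s) g c = \sum_c (count_mem c s)%:R * g c.
Proof.
elim: s => [|a s IHs]; first by rewrite big_nil big1 // => c _; rewrite mul0r.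
rewrite big_cons IHs /=; under [RHS]eq_bigr do rewrite natrD mulrDl.
rewrite big_split /= [X in _ = X + _](bigD1 a) //= eqxx mul1r; congr (_ + _).
rewrite big1 ?addr0 // => c /negbTE; rewrite eq_sym => ->; by rewrite mul0r.
Qed.

(** By [fd_lim] for letters the average of [d] over [infl k [:: a]] tends to its [wt]-mean 0; as the
    alphabet is finite, one [k] serves all [a]. *)
Let infl_average (d : A -> R) e : 0 < e -> \sum_c wt c * d c = 0 ->
  exists k, forall a, `|\sum_(c <- infl k [:: a]) d c| <= e * (size (infl k [:: a]))%:R.
Proof.
move=> e0 d0.
have lim a : (\sum_(c <- infl k [:: a]) d c) / (size (infl k [:: a]))%:R
    @[k --> \oo] --> 0.
  have sumE : \sum_c m [:: c] * d c = 0.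
    by rewrite -[RHS]d0; apply: eq_bigr => c _; rewrite (m_letter fd).
  under eq_fun do rewrite count_sum mulr_suml.
  suff : \sum_c (count_mem c (infl k [:: a]))%:R * d c / (size (infl k [:: a]))%:R
      @[k --> \oo] --> \sum_c m [:: c] * d c by rewrite sumE.
  apply: cvg_sum_seq => c; under eq_fun do rewrite mulrAC -(mean_occ_letter compat).
  by apply: cvgM; [exact: (fd_lim fd a (legal_letter fd c))|exact: cvg_cst].
have near_all : \forall k \near \oo, forall a,
    `|0 - (\sum_(c <- infl k [:: a]) d c) / (size (infl k [:: a]))%:R| <= e.
  by apply: filter_forall => a; exact: (cvgrPdist_le _ _).1 (lim a) e e0.
have [k _ /(_ k (leqnn k)) hk] := near_all.
exists k => a; have sz : 0 < (size (infl k [:: a]))%:R :> R by rewrite ltr0n infl1_gt0.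
have := hk a; rewrite sub0r normrN normrM normfV (ger0_norm (ltW sz)).
by rewrite ler_pdivrMr.
Qed.

Lemma iter_prob_split k a w s : P k (a :: w) s != 0 ->
  exists s1 s2, [/\ s = s1 ++ s2, perm_eq s1 (infl k [:: a]) & P k w s2 != 0].
Proof.
move=> nz; have ss := iter_prob_size compat nz.
rewrite -cat1s size_infl_cat in ss.
have sz1 : size (take (size (infl k [:: a])) s) = size (infl k [:: a]).
  by rewrite size_takel // ss leq_addr.
exists (take (size (infl k [:: a])) s), (drop (size (infl k [:: a])) s).
move: nz; rewrite -{1}(cat_take_drop (size (infl k [:: a])) s) -cat1s.
rewrite (iter_prob_cat compat) // mulf_eq0 negb_or => /andP[nz1 nz2].
by split=> //; [rewrite cat_take_drop|exact: iter_prob_perm compat _ _ _ nz1].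
Qed.

(* Cut a subword of theta^k(w) at the boundaries of the images of the letters
   of w: only the two end pieces fail to be complete images. *)
Let infl_discrepancy (d : A -> R) e k D :
  (forall a, `|\sum_(c <- infl k [:: a]) d c| <= e * (size (infl k [:: a]))%:R) ->
  (forall a s, (size s <= size (infl k [:: a]))%N -> `|\sum_(c <- s) d c| <= D) ->
  0 <= e -> 0 <= D -> forall w s i n, P k w s != 0 ->
  `|\sum_(c <- take n (drop i s)) d c| <= e * (size (take n (drop i s)))%:R + (D + D).
Proof.
move=> dk dD e0 D0.
have eR n : 0 <= e * n%:R by rewrite mulr_ge0.
have nil_case w s : w = [::] -> P k w s != 0 -> s = [::].
  by move=> -> /(iter_prob_size compat) ss; apply/nilP; rewrite /nilp ss infl_nil.
(* A prefix has an incomplete image only at its right end, so a single [D] is enough. *)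
have pre w : forall s n, P k w s != 0 ->
    `|\sum_(c <- take n s) d c| <= e * (size (take n s))%:R + D.
  elim: w => [|a w IHw] s n nz.
    by rewrite (nil_case _ _ erefl nz) big_nil normr0 addr_ge0.
  have [s1 [s2 [-> s1a nz2]]] := iter_prob_split nz.
  have [ns1|s1n] := leqP n (size s1).
    rewrite takel_cat // (le_trans (dD a _ _)) ?lerDr //.
    by rewrite size_takel // (leq_trans ns1) // (perm_size s1a).
  rewrite take_cat ltnNge (ltnW s1n) /= big_cat size_cat natrD mulrDr -addrA.
  rewrite (le_trans (ler_normD _ _)) // lerD ?IHw //.
  by rewrite (perm_big _ s1a) (perm_size s1a).
elim=> [|a w IHw] s i n nz.
  by rewrite (nil_case _ _ erefl nz) big_nil normr0 !addr_ge0.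
have [s1 [s2 [-> s1a nz2]]] := iter_prob_split nz.
rewrite drop_cat; case: ltnP => [is1|_]; last exact: IHw.
have dD1 t : (size t <= size s1)%N -> `|\sum_(c <- t) d c| <= D.
  by rewrite (perm_size s1a); exact: dD.
have [nt|tn] := leqP n (size (drop i s1)).
  rewrite takel_cat // (le_trans (dD1 _ _)) ?addrA ?lerDr ?addr_ge0 //.
  by rewrite size_takel // (leq_trans nt) // size_drop leq_subr.
rewrite take_cat ltnNge (ltnW tn) /= big_cat size_cat natrD mulrDr.
apply: le_trans (ler_normD _ _) _.
have h1 : `|\sum_(c <- drop i s1) d c| <= D by rewrite dD1 // size_drop leq_subr.
have h2 := pre w s2 (n - size (drop i s1))%N nz2.
by have := eR (size (drop i s1)); lra.
Qed.

(** Centre [g] and cut the word into images under theta^k, with [k] such that complete images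
    deviate by at most e/2 per letter; the end pieces cost a constant, absorbed by the length. *)
Lemma legal_discrepancy (g : A -> R) e : 0 < e ->
  exists N, forall v, legal th v -> (N <= size v)%N ->
    `|\sum_(c <- v) g c - (size v)%:R * \sum_c wt c * g c| <= e * (size v)%:R.
Proof.
move=> e0; set gbar := \sum_c wt c * g c; pose d c := g c - gbar.
have dE v : \sum_(c <- v) g c - (size v)%:R * gbar = \sum_(c <- v) d c.
  by rewrite sumrB big_const_seq count_predT iter_addr_0 mulr_natl.
have d0 : \sum_c wt c * d c = 0.
  under eq_bigr do rewrite mulrBr.
  by rewrite sumrB -mulr_suml (fd_wt_sum1 fd) mul1r subrr.
have e20 : 0 < e / 2 by rewrite divr_gt0.
have [k dk] := infl_average e20 d0.
pose L := (\max_c size (infl k [:: c]))%N.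
have L_max c : (size (infl k [:: c]) <= L)%N by exact: leq_bigmax.
pose B := \sum_c `|d c|; have B0 : 0 <= B by exact: sumr_ge0.
pose D := L%:R * B; have D0 : 0 <= D by rewrite mulr_ge0.
have dD a s : (size s <= size (infl k [:: a]))%N -> `|\sum_(c <- s) d c| <= D.
  move=> sa; rewrite (le_trans (ler_norm_sum _ _ _)) //.
  apply: (@le_trans _ _ ((size s)%:R * B)); last first.
    by rewrite ler_wpM2r // ler_nat (leq_trans sa).
  rewrite mulr_natl -iter_addr_0 -(count_predT s) -big_const_seq.
  by apply: ler_sum => c _; rewrite /B (bigD1 c) //= lerDl sumr_ge0.
(* Length above [L] excludes subwords of theta^K(a) with K < k; length above 4D/e makes the cost 2D
   of the ends at most half of e |v|. *)
exists (maxn L.+1 (Num.truncn (4 * D / e)).+1) => v [K [a [s [K0 Ks vs]]]].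
rewrite geq_max => /andP[Lv Dv]; rewrite dE.
move: Ks; rewrite /iter_words /= => /lt0r_neq0 Ks.
have [kK|Kk] := leqP k K; last first.
  have : (size v <= L)%N.
    apply: leq_trans (size_infix vs) _; rewrite (iter_prob_size compat Ks).
    apply: leq_trans (L_max a); rewrite -(subnKC (ltnW Kk)) inflD.
    exact: size_infl_ge.
  by rewrite leqNgt Lv.
have [w Pw] : exists w, P k w s != 0.
  move: Ks; rewrite -(subnK kK) (iter_prob_comp compat) => /eqP nz.
  apply: contrapT => none; apply: nz; apply: big1 => w _.
  have [->|Pw] := eqVneq (P k w s) 0; first by rewrite mulr0.
  by exfalso; apply: none; exists w.
move: vs => /infixP[x [y sE]].
have := infl_discrepancy dk dD (ltW e20) D0 (size x) (size v) Pw.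
rewrite sE drop_size_cat // take_size_cat // => /le_trans; apply.
have : 4 * D / e < (size v)%:R.
  apply: (lt_le_trans (truncnS_gt _)); by rewrite ler_nat.
by rewrite ltr_pdivrMr // => h; lra.
Qed.

End frequency_consequences.

(** * Renewal inequalities for the partition sums *)

Section partition_sums.
Context {R : realType} {A : finType} {th : random_substitution R A}.
Context {lam : R} {wt : A -> R} {m : seq A -> R}.
Context (fd : frequency_data th lam wt m).
Implicit Types (u v w s t x y z : seq A) (a c : A) (b : bool) (q : R).

Local Notation P := (iter_prob th).
Local Notation infl := (infl th).
Local Notation infl_sum := (infl_sum th).

Let compat := fd_compat fd.

Let lamX_gt0 k : 0 < lam ^+ k.
Proof. by rewrite exprn_gt0 // (lt_trans ltr01 (fd_lam_gt1 fd)). Qed.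

(** This is Z_n; [m] vanishes on illegal words, so only legal ones contribute, also for q <= 0. *)
Definition part_sum q n : R := \sum_(u <- words n) pw q (m u).

Lemma m_neq0_legal v : m v != 0 -> legal th v.
Proof. by apply: contra_neqP => nl; exact: (fd_illegal fd). Qed.

Lemma part_sum_gt0 q n : 0 < part_sum q n.
Proof.
have [[u un mu]|none] := pselect (exists2 u, u \in words n & m u != 0).
  rewrite /part_sum (bigD1_seq u) ?words_uniq //= ltr_pwDl //.
    by rewrite pw_gt0 // lt0r mu (m_ge0 fd).
  by apply: sumr_ge0 => v _; exact: pw_ge0.
have := m_sum1 fd n; rewrite big_seq big1 => [/eqP|u un].
  by rewrite eq_sym oner_eq0.
by apply/eqP/negPn/negP => mu; apply: none; exists u.
Qed.

(** Flattens the sum over blocks and positions into one list of pairs, the form required by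
    [pw_jensen]. *)
Let big_head k p (F : seq A -> nat -> R) :
  \sum_(x <- [seq (v, j) | v <- words p, j <- iota 0 (size (infl k (take 1 v)))])
    F x.1 x.2 =
  \sum_(v <- words p) \sum_(j < size (infl k (take 1 v))) F v j.
Proof.
rewrite big_allpairs_dep; apply: eq_bigr => v _.
by rewrite -(big_mkord xpredT (F v)) /index_iota subn0.
Qed.

Section fixed_scale.
Context (k n p : nat) (p_gt0 : (0 < p)%N).
Context (p_large : forall v, legal th v -> size v = p ->
  (n <= size (infl k (behead v)))%N).

Let window_fits v j : legal th v -> size v = p ->
  (j < size (infl k (take 1 v)))%N -> (j + n <= size (infl k v))%N.
Proof.
move=> lv vp jv; rewrite -[X in (_ <= size (infl _ X))%N](cat_take_drop 1) drop1.
by rewrite size_infl_cat leq_add ?p_large // ltnW.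
Qed.

(** Raise the renewal identity to the power q, distribute by sub- or superadditivity over [v] and
    [j], then sum over [u] first. *)
Lemma part_sum_covering b q : rle b q 1 ->
  rle b (pw q (lam ^+ k) * part_sum q n)
    (\sum_(v <- words p) pw q (m v) *
       ((size (infl k (take 1 v)))%:R * infl_sum k q v)).
Proof.
move=> q1; rewrite mulr_sumr.
apply: rle_trans (_ : rle b _ (\sum_(u <- words n) \sum_(v <- words p)
    \sum_(j < size (infl k (take 1 v))) pw q (m v) * pw q (window_prob th k n v j u))) _.
  rewrite [X in rle b X _]big_seq [X in rle b _ X]big_seq.
  apply: rle_sum => u /size_words un.
  rewrite -pwM ?(m_ge0 fd) // ?(ltW (lamX_gt0 k)) //.
  rewrite (m_renewal fd (n := n) (p := p)) //.
  apply: rle_trans (pw_sum _ _ q1 _) _ => [v|].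
    by rewrite mulr_ge0 ?(m_ge0 fd) ?head_occ_ge0.
  apply: rle_sum => v _; rewrite -mulr_sumr pwM ?(m_ge0 fd) ?head_occ_ge0 //.
  apply: rle_pM (pw_ge0 _ _) _; apply: pw_sum => // j; exact: window_prob_ge0.
rewrite exchange_big /= [X in rle b X _]big_seq [X in rle b _ X]big_seq.
apply: rle_sum => v /size_words vp; rewrite exchange_big /=.
under eq_bigr do rewrite -mulr_sumr.
rewrite -mulr_sumr; have [->|mv] := eqVneq (m v) 0.
  by rewrite pw0 !mul0r rle_refl.
apply: rle_pM (pw_ge0 _ _) _.
rewrite -[X in rle b _ (X%:R * _)]card_ord mulr_natl -sumr_const.
apply: rle_sum => j _; apply: window_prob_covering => //.
exact: window_fits (m_neq0_legal mv) vp (ltn_ord j).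
Qed.

(** Jensen for the renewal identity, the weights m(v) / lam^k over pairs (v, j) having total 1 by
    [m_head_size]. Images of p' + 1 letters have length at most [n], so the window covers the images
    of the p' letters after the first. *)
Lemma part_sum_interior b q p' : rle b q 1 -> 0 <= q -> (p' < p)%N ->
  (forall v, legal th v -> size v = p'.+1 -> (size (infl k v) <= n)%N) ->
  rle b (\sum_(v <- words p) m v / lam ^+ k *
       ((size (infl k (take 1 v)))%:R * infl_sum k q (take p' (behead v))))
        (part_sum q n).
Proof.
move=> q1 q0 p'p p'_small.
apply: rle_trans (_ : rle b _ (\sum_(u <- words n) \sum_(v <- words p)
    \sum_(j < size (infl k (take 1 v))) m v / lam ^+ k *
       pw q (window_prob th k n v j u))) _; last first.
  rewrite [X in rle b X _]big_seq [X in rle b _ X]big_seq.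
  apply: rle_sum => u /size_words un.
  rewrite -(big_head k p (fun v j => m v / lam ^+ k * pw q (window_prob th k n v j u))).
  have -> : m u = \sum_(x <- [seq (v, j) | v <- words p,
      j <- iota 0 (size (infl k (take 1 v)))]) m x.1 / lam ^+ k *
      window_prob th k n x.1 x.2 u.
    rewrite (big_head k p (fun v j => m v / lam ^+ k * window_prob th k n v j u)).
    apply: (mulfI (lt0r_neq0 (lamX_gt0 k))).
    rewrite (m_renewal fd (n := n) (p := p)) // mulr_sumr; apply: eq_bigr => v _.
    rewrite -mulr_sumr mulrA mulrCA mulfV ?mulr1 ?(lt0r_neq0 (lamX_gt0 k)) //.
  apply: pw_jensen => // [x|x|].
  - by rewrite divr_ge0 ?(m_ge0 fd) ?(ltW (lamX_gt0 k)).
  - exact: window_prob_ge0.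
  - rewrite (big_head k p (fun v _ => m v / lam ^+ k)).
    under eq_bigr do rewrite sumr_const card_ord -mulr_natr mulrAC.
    by rewrite -mulr_suml (m_head_size fd) // divff // (lt0r_neq0 (lamX_gt0 k)).
rewrite exchange_big /= [X in rle b X _]big_seq [X in rle b _ X]big_seq.
apply: rle_sum => v /size_words vp; rewrite exchange_big /=.
under eq_bigr do rewrite -mulr_sumr.
rewrite -mulr_sumr; have [->|mv] := eqVneq (m v) 0.
  by rewrite !mul0r rle_refl.
have lv := m_neq0_legal mv.
apply: rle_pM; first by rewrite divr_ge0 ?(m_ge0 fd) ?(ltW (lamX_gt0 k)).
rewrite -[X in rle b (X%:R * _) _]card_ord mulr_natl -sumr_const.
apply: rle_sum => -[j jv] _ /=.
have vE : v = take 1 v ++ take p' (behead v) ++ drop p' (behead v).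
  by rewrite cat_take_drop -drop1 cat_take_drop.
have := @window_prob_interior _ _ _ compat b k q n (take 1 v) (take p' (behead v))
  (drop p' (behead v)) j q1.
rewrite -vE; apply.
- exact: ltnW jv.
- apply: leq_trans (leq_addl _ _); apply: p'_small.
    by apply: infix_legal lv _; rewrite [X in infix _ X]vE catA prefixW // prefix_prefix.
  rewrite size_cat !size_takel ?size_behead ?vp // -ltnS.
  by rewrite prednK.
- exact: window_fits lv vp jv.
Qed.

End fixed_scale.

End partition_sums.

Arguments part_sum {R A} m q n.

(** * Growth of the partition sums *)

Section recursion.
Context {R : realType}.

(** The slope x = gam theta / (1 - theta) solves x = theta x + gam theta; with slack d/2 in the
    slope, z(n) <= B + x n follows by strong induction. *)
Lemma sublinear_recursion (z : nat -> R) (theta gam : R) :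
  0 < theta -> theta < 1 ->
  (forall e, 0 < e -> exists r : R, forall n, r <= n%:R -> exists p,
     `|p%:R - theta * n%:R| <= e * n%:R /\
     z n <= z p + gam * theta * n%:R + e * n%:R) ->
  forall d, 0 < d -> exists r : R, forall n, r <= n%:R ->
    z n <= (gam * theta / (1 - theta) + d) * n%:R.
Proof.
move=> th0 th1 H d d0; set x := gam * theta / (1 - theta) + d / 2.
have t1 : 0 < 1 - theta by rewrite subr_gt0.
have xE : (1 - theta) * x = gam * theta + d * (1 - theta) / 2.
  by rewrite /x; field; rewrite gt_eqF.
have nx1 : 0 < 1 + `|x| by rewrite ltr_wpDr.
(* The first bound forces p < n; the second fits the errors e n and |x| e n into the slack. *)
pose e := Num.min ((1 - theta) / 2) (d * (1 - theta) / 2 / (1 + `|x|)).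
have e0 : 0 < e by rewrite lt_min !divr_gt0 // mulr_gt0.
have e1 : e <= (1 - theta) / 2 by rewrite ge_min lexx.
have e2 : e * (1 + `|x|) <= d * (1 - theta) / 2.
  by rewrite -ler_pdivlMr // ge_min lexx orbT.
have [r Hr] := H e e0; pose N := (Num.truncn r).+1.
(* [B] settles all n below the threshold [N]. *)
pose B := \sum_(i < N) `|z i - x * i%:R|.
have claim n : z n <= B + x * n%:R.
  elim/ltn_ind: n => n IHn; have [nN|Nn] := ltnP n N.
    rewrite -lerBlDr (le_trans (ler_norm _)) // /B (bigD1 (Ordinal nN)) //=.
    by rewrite lerDl sumr_ge0.
  have rn : r <= n%:R by rewrite (le_trans (ltW (truncnS_gt r))) // ler_nat.
  have n0 : 0 < n%:R :> R by rewrite ltr0n (leq_trans _ Nn).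
  have [p [pn zp]] := Hr n rn.
  have p_lt : (p < n)%N.
    rewrite -(ltr_nat R); have := ler_norm (p%:R - theta * n%:R).
    have := ler_wpM2r (ltW n0) e1; have : 0 < (1 - theta) * n%:R by rewrite mulr_gt0.
    by move: pn; lra.
  have zB := IHn p p_lt.
  have xp : x * p%:R <= x * theta * n%:R + `|x| * (e * n%:R).
    have := ler_norm (x * (p%:R - theta * n%:R)); rewrite normrM => h.
    have h' := ler_wpM2l (normr_ge0 x) pn; rewrite mulrBr in h; lra.
  have := ler_wpM2r (ltW n0) e2.
  have : x * n%:R = (x * theta + gam * theta + d * (1 - theta) / 2) * n%:R.
    by congr (_ * _); rewrite -addrA -xE; ring.
  by lra.
exists (2 * B / d) => n Bn; apply: le_trans (claim n) _.
by move: Bn; rewrite ler_pdivrMr // /x; lra.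
Qed.

End recursion.

Section asymptotics.
Context {R : realType} {A : finType} {th : random_substitution R A}.
Context {lam : R} {wt : A -> R} {m : seq A -> R}.
Context (fd : frequency_data th lam wt m).
Implicit Types (u v w s t x y z : seq A) (a c : A) (b : bool) (q e : R).

Local Notation infl := (infl th).
Local Notation infl_sum := (infl_sum th).
Local Notation part_sum := (part_sum m).

Let compat := fd_compat fd.

Context (k : nat) (k_gt0 : (0 < k)%N).

Let theta : R := lam ^- k.

Let lam_gt0 : 0 < lam := lt_trans ltr01 (fd_lam_gt1 fd).

Let theta_gt0 : 0 < theta.
Proof. by rewrite invr_gt0 exprn_gt0. Qed.

Let theta_lt1 : theta < 1.
Proof.
by rewrite invf_lt1 ?exprn_gt0 // exprn_egt1 ?(fd_lam_gt1 fd) // -lt0n.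
Qed.

(** Images of long legal words have length about lam^k times that of the word, so p slightly above
    theta n and p' slightly below it satisfy the two covering conditions. *)
Lemma word_lengths e : 0 < e -> e < theta ->
  exists r : R, forall n, r <= n%:R -> exists p p', [/\ (0 < p)%N, (p' < p)%N,
    (forall v, legal th v -> size v = p -> (n <= size (infl k (behead v)))%N),
    (forall v, legal th v -> size v = p'.+1 -> (size (infl k v) <= n)%N) &
    `|p%:R - theta * n%:R| <= 2 * e * n%:R /\
    `|p'%:R - theta * n%:R| <= 2 * e * n%:R].
Proof.
move=> e0 et; set L := lam ^+ k; have L0 : 0 < L by rewrite exprn_gt0.
have LE : L = theta^-1 by rewrite /theta invrK.
have te0 : 0 < theta + e by rewrite addr_gt0.
have te0' : 0 < theta - e by rewrite subr_gt0.
(* Tolerances for which the image length per letter is at least 1 / (theta + e), respectively at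
   most 1 / (theta - e). *)
have e1 : 0 < L - (theta + e)^-1 by rewrite subr_gt0 LE ltf_pV2 ?posrE // ltrDl.
have e2 : 0 < (theta - e)^-1 - L by rewrite subr_gt0 LE ltf_pV2 ?posrE // gtrBl.
pose g c : R := (size (infl k [:: c]))%:R.
have gE v : \sum_(c <- v) g c = (size (infl k v))%:R.
  by rewrite -natr_sum -size_infl_sum.
have gbar : \sum_c wt c * g c = L by exact: (wt_size_infl fd).
have [N1 H1] := legal_discrepancy fd g e1.
have [N2 H2] := legal_discrepancy fd g e2.
exists (Num.max (2 / e) (Num.max (N1%:R / (theta + e)) (N2.+1%:R / (theta - e)))) => n.
rewrite !ge_max !ler_pdivrMr // => /andP[n2 /andP[nN1 nN2]].
have n0 : 0 <= n%:R :> R by [].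
pose p0 := Num.truncn ((theta + e) * n%:R).
pose t := Num.truncn ((theta - e) * n%:R).
have p0l : p0%:R <= (theta + e) * n%:R by rewrite truncn_le mulr_ge0 // ltW.
have p0g : (theta + e) * n%:R < p0.+1%:R by exact: truncnS_gt.
have tl : t%:R <= (theta - e) * n%:R by rewrite truncn_le mulr_ge0 // ltW.
have tg : (theta - e) * n%:R < t.+1%:R by exact: truncnS_gt.
have N2t : (N2 < t)%N by rewrite -ltnS -(ltr_nat R) (le_lt_trans _ tg) // mulrC.
have t0 : (0 < t)%N by exact: leq_ltn_trans N2t.
have tp1 : t.-1%:R = t%:R - 1 :> R by rewrite -[in RHS](prednK t0) -natr1 addrK.
rewrite -natr1 in p0g; rewrite -natr1 in tg.
(* Without its first letter the block has p0 + 1 > (theta + e) n letters, and p' + 1 = t <= (theta -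
   e) n; n >= 2/e absorbs the rounding. *)
exists p0.+2, t.-1; split=> //.
- rewrite -(ltr_nat R) tp1 -2!natr1; have := ler_wpM2r n0 (ltW e0); lra.
- move=> v lv vp.
  have sb : size (behead v) = p0.+1 by rewrite size_behead vp.
  have lb : legal th (behead v).
    by apply: infix_legal lv _; rewrite -drop1 suffixW // suffix_drop.
  have Nb : (N1 <= size (behead v))%N.
    by rewrite sb -(ler_nat R) -natr1 (le_trans nN1) // mulrC ltW.
  have := H1 _ lb Nb; rewrite gE gbar sb ler_norml => /andP[h _].
  rewrite -(ler_nat R); apply: (@le_trans _ _ ((theta + e)^-1 * p0.+1%:R)).
    by rewrite mulrC ler_pdivlMr // mulrC -natr1 ltW.
  by move: h; rewrite !mulrBl; lra.
- move=> v lv vp; rewrite prednK // in vp.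
  have Nv : (N2 <= size v)%N by rewrite vp ltnW.
  have := H2 _ lv Nv; rewrite gE gbar vp ler_norml => /andP[_ h].
  rewrite -(ler_nat R); apply: (@le_trans _ _ ((theta - e)^-1 * t%:R)).
    by move: h; rewrite !mulrBl; lra.
  by rewrite mulrC ler_pdivrMr // mulrC.
- by rewrite tp1 -2!natr1 !ler_norml; split; apply/andP; split; lra.
Qed.

(** This is -phi_k(q). *)
Let G q : R := \sum_c wt c * ln (infl_sum k q [:: c]).

(** [legal_discrepancy] for the letter function ln S_k(c); e <= theta / 4 keeps |y| above theta n /
    2, hence above its threshold. *)
Lemma ln_infl_sum_approx q e : 0 < e -> e <= theta / 4 ->
  exists r : R, forall n y, r <= n%:R -> legal th y ->
    `|(size y)%:R - theta * n%:R| <= 2 * e * n%:R ->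
    `|ln (infl_sum k q y) - G q * (theta * n%:R)| <= e * (2 * `|G q| + 3) * n%:R.
Proof.
move=> e0 et.
have [N H] := legal_discrepancy fd (fun c => ln (infl_sum k q [:: c])) e0.
exists (N%:R / (theta / 2)) => n y; rewrite ler_pdivrMr ?divr_gt0 // => nN ly yn.
have n0 : 0 <= n%:R :> R by [].
have := yn; rewrite ler_norml => /andP[y1 y2].
have en := ler_wpM2r n0 et.
have Ny : (N <= size y)%N by rewrite -(ler_nat R); lra.
have := H y ly Ny; rewrite -(ln_infl_sum compat) -/(G q) => h.
have -> : ln (infl_sum k q y) - G q * (theta * n%:R) =
  (ln (infl_sum k q y) - (size y)%:R * G q) + G q * ((size y)%:R - theta * n%:R).
  by ring.
apply: le_trans (ler_normD _ _) _; rewrite normrM.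
have h2 := ler_wpM2l (normr_ge0 (G q)) yn.
have h3 : e * (size y)%:R <= e * (3 * n%:R).
  rewrite ler_pM2l //; have := ler_wpM2r n0 (ltW theta_lt1); lra.
lra.
Qed.

(** A sign that turns [rle b] into [<=], so that limits and linear arithmetic treat both cases
    together. *)
Definition dir b (x : R) : R := if b then x else - x.

Lemma rle_dir b (x y : R) : rle b x y = (dir b x <= dir b y).
Proof. by case: b => //=; rewrite lerN2. Qed.

Lemma rle_ln_expR b (x y e : R) : 0 < x -> `|ln x - y| <= e ->
  rle b x (expR (y + dir b e)) /\ rle b (expR (y - dir b e)) x.
Proof.
move=> x0; rewrite ler_norml => /andP[h1 h2]; rewrite -{1 2}[x]lnK ?posrE //.
by case: b => /=; rewrite !ler_expR; split; lra.
Qed.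

(** The logarithm of [part_sum_covering], with ln S_k(v) replaced by theta n G up to o(n). *)
Lemma part_sum_recursion b q : rle b q 1 -> forall e, 0 < e ->
  exists r : R, forall n, r <= n%:R -> exists p,
    `|p%:R - theta * n%:R| <= e * n%:R /\
    dir b (ln (part_sum q n)) <=
      dir b (ln (part_sum q p)) + dir b (G q) * theta * n%:R + e * n%:R.
Proof.
move=> q1 e e0; have G0 : 0 < 2 * `|G q| + 4 by have := normr_ge0 (G q); lra.
pose h := Num.min (theta / 4) (e / (2 * `|G q| + 4)).
have h0 : 0 < h by rewrite lt_min !divr_gt0.
have h1 : h <= theta / 4 by rewrite ge_min lexx.
have h2 : h * (2 * `|G q| + 4) <= e by rewrite -ler_pdivlMr // ge_min lexx orbT.
have ht : h < theta by have := theta_gt0; lra.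
have [r1 H1] := word_lengths h0 ht.
have [r2 H2] := ln_infl_sum_approx q h0 h1.
pose L := (\max_c size (infl k [:: c]))%N.
(* Bound on the number of starting positions: from above for q <= 1, from below for q >= 1. *)
pose W := (if b then L.+1%:R else 1) : R.
have Wge c : rle b (size (infl k [:: c]))%:R W.
  by rewrite /W; case: (b) => /=; rewrite ?ler_nat ?ler1n ?infl1_gt0 // leqW //
    /L leq_bigmax.
pose K := `|ln W| + `|ln (pw q (lam ^+ k))|.
exists (Num.max r1 (Num.max r2 (K / h))) => n; rewrite !ge_max => /andP[r1n /andP[r2n]].
rewrite ler_pdivrMr // => Kn; have n0 : 0 <= n%:R :> R by [].
have [p [p' [p_gt0 _ p_large _ [pn _]]]] := H1 n r1n; exists p.
have h2n := ler_wpM2r n0 h2.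
have Gn : 0 <= h * `|G q| * n%:R by rewrite !mulr_ge0 // ltW.
have hn : 0 <= h * n%:R by rewrite mulr_ge0 // ltW.
split; first by apply: le_trans pn _; lra.
have W0 : 0 < W by rewrite /W; case: (b); rewrite ?ltr01 ?ltr0n.
set X := expR (G q * (theta * n%:R) + dir b (h * (2 * `|G q| + 3) * n%:R)).
have main : rle b (pw q (lam ^+ k) * part_sum q n) (W * X * part_sum q p).
  apply: rle_trans (part_sum_covering fd p_gt0 p_large q1) _.
  rewrite mulr_sumr [X in rle b X _]big_seq [X in rle b _ X]big_seq.
  apply: rle_sum => -[|c v] /size_words vp; first by rewrite -vp in p_gt0.
  rewrite [X in rle b _ X]mulrC /= take0.
  have [->|mv] := eqVneq (m (c :: v)) 0; first by rewrite pw0 !mul0r rle_refl.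
  apply: rle_pM (pw_ge0 _ _) _; have lv := m_neq0_legal fd mv.
  have Sv : rle b (infl_sum k q (c :: v)) X.
    by apply: (rle_ln_expR _ (infl_sum_gt0 compat _ _ _) (H2 n _ r2n lv _)).1; rewrite vp.
  apply: rle_trans (rle_pM (ler0n _ _) Sv) _.
  by rewrite mulrC [W * X]mulrC; apply: rle_pM (expR_ge0 _) (Wge _).
have Z0 i := part_sum_gt0 fd q i; have X0 : 0 < X by exact: expR_gt0.
have pw_lam : 0 < pw q (lam ^+ k) by rewrite pw_gt0 // exprn_gt0.
have := rle_ln (mulr_gt0 pw_lam (Z0 n)) (mulr_gt0 (mulr_gt0 W0 X0) (Z0 p)) main.
rewrite !lnM ?posrE ?mulr_gt0 // [ln X]expRK.
have nW := ler_norm (ln W); have nW' := ler_norm (- ln W); rewrite normrN in nW'.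
have nl := ler_norm (ln (pw q (lam ^+ k))); have nl' := ler_norm (- ln (pw q (lam ^+ k))).
rewrite normrN in nl'.
by move: Kn; rewrite /K; case: (b) => /=; lra.
Qed.

Lemma part_sum_jensen b q : rle b q 1 -> 0 <= q -> forall e, 0 < e ->
  exists r : R, forall n, r <= n%:R ->
    dir b (G q * theta * n%:R) - e * n%:R <= dir b (ln (part_sum q n)).
Proof.
move=> q1 q0 e e0; have G0 : 0 < 2 * `|G q| + 4 by have := normr_ge0 (G q); lra.
pose h := Num.min (theta / 4) (e / (2 * `|G q| + 4)).
have h0 : 0 < h by rewrite lt_min !divr_gt0.
have h1 : h <= theta / 4 by rewrite ge_min lexx.
have h2 : h * (2 * `|G q| + 4) <= e by rewrite -ler_pdivlMr // ge_min lexx orbT.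
have ht : h < theta by have := theta_gt0; lra.
have [r1 H1] := word_lengths h0 ht.
have [r2 H2] := ln_infl_sum_approx q h0 h1.
exists (Num.max r1 r2) => n; rewrite !ge_max => /andP[r1n r2n].
have n0 : 0 <= n%:R :> R by [].
have [p [p' [p_gt0 p'p p_large p'_small [_ p'n]]]] := H1 n r1n.
have h2n := ler_wpM2r n0 h2.
have hn : 0 <= h * n%:R by rewrite mulr_ge0 // ltW.
set X := expR (G q * (theta * n%:R) - dir b (h * (2 * `|G q| + 3) * n%:R)).
have main : rle b X (part_sum q n).
  apply: rle_trans (part_sum_interior fd p_gt0 p_large q1 q0 p'p p'_small).
  (* The constant [X] is its own average, since the weights have total 1; the comparison can then be
     made block by block. *)
  have XE : X = \sum_(v <- words p) m v / lam ^+ k *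
      ((size (infl k (take 1 v)))%:R * X).
    have LE := m_head_size fd k p_gt0; have L0 : lam ^+ k != 0.
      by rewrite gt_eqF // exprn_gt0.
    rewrite -[LHS](mulKf L0) -[Y in _ * (Y * _)]LE mulr_suml mulr_sumr; apply: eq_bigr => v _.
    by ring.
  rewrite [X in rle b X _]XE [X in rle b X _]big_seq [X in rle b _ X]big_seq.
  apply: rle_sum => v /size_words vp.
  have [->|mv] := eqVneq (m v) 0; first by rewrite !mul0r rle_refl.
  apply: rle_pM; first by rewrite divr_ge0 ?(m_ge0 fd) // exprn_ge0 // ltW.
  apply: rle_pM (ler0n _ _) _.
  have lv := m_neq0_legal fd mv.
  apply: (rle_ln_expR _ (infl_sum_gt0 compat _ _ _) (H2 n _ r2n _ _)).2.
    apply: infix_legal lv _; apply: infix_trans (prefixW (prefix_take _ _)) _.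
    by rewrite -drop1 suffixW // suffix_drop.
  by rewrite size_takel // size_behead vp -ltnS prednK.
have := rle_ln (expR_gt0 _) (part_sum_gt0 fd q n) main; rewrite [ln X]expRK.
by case: (b) => /=; lra.
Qed.

End asymptotics.

(** * Convergence of the spectra *)

(** X_k decreases and is bounded below, and 1 - th^k tends to 1, so both bounds share one limit.
    Indices start at 1 because 1 - th^0 = 0. *)
Lemma sandwich_limit (R : realType) (X T : nat -> R) (th : R) :
  0 < th -> th < 1 -> (forall k, X k.+2 <= X k.+1) ->
  (forall k d, (0 < k)%N -> 0 < d -> exists r : R, forall n, r <= n%:R ->
     X k / (1 - th ^+ k) - d <= T n <= X k + d) ->
  exists l, [/\ T n @[n --> \oo] --> l, X n @[n --> \oo] --> l &
    forall k, (0 < k)%N -> X k / (1 - th ^+ k) <= l <= X k].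
Proof.
move=> th0 th1 X_mono H.
(* Both sides are compared with [T n] at one large n. *)
have YX j k : (0 < j)%N -> (0 < k)%N -> X j / (1 - th ^+ j) <= X k.
  move=> j0 k0; apply/ler_addgt0Pr => d d0; have d20 : 0 < d / 2 by rewrite divr_gt0.
  have [r1 H1] := H j _ j0 d20; have [r2 H2] := H k _ k0 d20.
  pose n := (Num.truncn (Num.max r1 r2)).+1.
  have : Num.max r1 r2 <= n%:R by rewrite ltW // truncnS_gt.
  rewrite ge_max => /andP[/H1/andP[h1 _] /H2/andP[_ h2]].
  by have := le_trans h1 h2; lra.
have X_noninc : nonincreasing_seq (fun k => X k.+1).
  by apply/nonincreasing_seqP => n; exact: X_mono.
have X_cvg : cvgn (fun k => X k.+1).
  apply: nonincreasing_is_cvgn => //.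
  by exists (X 1%N / (1 - th ^+ 1)) => _ [k _ <-]; exact: YX.
pose l := limn (fun k => X k.+1).
have Xl : X n @[n --> \oo] --> l by rewrite -cvg_shiftS; exact: X_cvg.
have Yl : X k / (1 - th ^+ k) @[k --> \oo] --> l.
  rewrite -[X in _ --> X]divr1; apply: cvgM => //.
  apply: cvgV; first exact: oner_neq0.
  rewrite -[X in _ --> X]subr0; apply: cvgB; first exact: cvg_cst.
  by apply: cvg_expr; rewrite ger0_norm ?(ltW th0).
have bounds k : (0 < k)%N -> X k / (1 - th ^+ k) <= l <= X k.
  move=> k0; apply/andP; split.
    apply: (cvgr_to_ge Xl); near=> j; apply: YX => //.
    by near: j; exact: nbhs_infty_gt.
  by rewrite -(prednK k0); exact: (nonincreasing_cvgn_ge X_noninc X_cvg k.-1).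
exists l; split=> //; apply/cvgrPdist_le => e e0.
have e20 : 0 < e / 2 by rewrite divr_gt0.
have [k [k0 Xk Yk]] : exists k, [/\ (0 < k)%N, `|l - X k| <= e / 2 &
    `|l - X k / (1 - th ^+ k)| <= e / 2].
  have near_k : \forall k \near \oo, [/\ (0 < k)%N, `|l - X k| <= e / 2 &
      `|l - X k / (1 - th ^+ k)| <= e / 2].
    near=> k; split; near: k; first exact: nbhs_infty_gt.
    - exact: (cvgrPdist_le _ _).1 Xl _ e20.
    - exact: (cvgrPdist_le _ _).1 Yl _ e20.
  by have [k _ /(_ k (leqnn k)) hk] := near_k; exists k.
have [r Hr] := H k _ k0 e20; near=> n.
have /Hr/andP[h1 h2] : r <= n%:R by near: n; exact: nbhs_infty_ger.
move: Xk Yk; rewrite !ler_norml => /andP[Xk _] /andP[_ Yk].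
by apply/andP; split; lra.
Unshelve. all: by end_near. Qed.

(** Serves q < 0, where only a lower bound on the limit inferior is claimed. *)
Lemma limn_einf_ge (R : realType) (T : nat -> R) (y : R) :
  (forall d, 0 < d -> exists r : R, forall n, r <= n%:R -> y - d <= T n) ->
  (y%:E <= limn_einf (fun n => (T n)%:E))%E.
Proof.
move=> H; apply/lee_addgt0Pr => d d0; rewrite -leeBlDr // -EFinB limn_einf_lim.
apply: lime_ge; first exact: is_cvg_einfs.
have [r Hr] := H d d0; near=> n; apply: le_ereal_inf_tmp => _ [j /= nj <-].
rewrite lee_fin Hr // (@le_trans _ _ n%:R) ?ler_nat //.
by near: n; exact: nbhs_infty_ger.
Unshelve. all: by end_near. Qed.

Lemma cvg_dir (R : realType) b (f : nat -> R) (l : R) :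
  dir b (f n) @[n --> \oo] --> l -> f n @[n --> \oo] --> dir b l.
Proof.
case: b => //= fl; rewrite (_ : f = - (fun n => - f n)); first exact: cvgN.
by apply/funext => n; rewrite /= opprK.
Qed.

Section spectra.
Context {R : realType} {A : finType} {th : random_substitution R A}.
Context {lam : R} {wt : A -> R} {m : seq A -> R}.
Context (fd : frequency_data th lam wt m).
Implicit Types (b : bool) (q : R).

Let compat := fd_compat fd.
Let lam_gt0 : 0 < lam := lt_trans ltr01 (fd_lam_gt1 fd).

Definition phi_wt k q : R := - \sum_c wt c * ln (infl_sum th k q [:: c]).

Definition Lq_val q n : R := - n%:R^-1 * ln (part_sum m q n).

(** [infl_sum_jensen] in logarithms, averaged over letters: the eigenvector equation produces the
    factor lam^i. *)
Lemma phi_wt_decr b q i k : rle b q 1 -> 0 <= q ->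
  rle b (lam ^- (i + k) * phi_wt (i + k) q) (lam ^- k * phi_wt k q).
Proof.
move=> q1 q0; rewrite exprD invfM [_^-1 * _^-1]mulrC -mulrA.
apply: rle_pM; first by rewrite invr_ge0 exprn_ge0 // ltW.
rewrite -[X in rle b _ X](mulKf (lt0r_neq0 (exprn_gt0 i lam_gt0))).
apply: rle_pM; first by rewrite invr_ge0 exprn_ge0 // ltW.
rewrite /phi_wt mulrN rleN -(wt_infl fd i (fun c => ln (infl_sum th k q [:: c]))).
apply: rle_sum => a _; apply: rle_pM; first by rewrite ltW // (fd_wt_gt0 fd).
rewrite -(ln_infl_sum compat); apply: rle_ln; try exact: infl_sum_gt0.
exact: infl_sum_jensen.
Qed.

(** The recursion with theta = lam^-k has slope theta G / (1 - theta) = G / (lam^k - 1). *)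
Lemma Lq_val_lower b q k d : rle b q 1 -> (0 < k)%N -> 0 < d ->
  exists r : R, forall n, r <= n%:R ->
    dir b ((lam ^+ k - 1)^-1 * phi_wt k q) - d <= dir b (Lq_val q n).
Proof.
move=> q1 k0 d0; set G := \sum_c wt c * ln (infl_sum th k q [:: c]).
have L1 : 1 < lam ^+ k by rewrite exprn_egt1 ?(fd_lam_gt1 fd) // -lt0n.
have L0 : 0 < lam ^+ k by exact: lt_trans ltr01 L1.
have th0 : 0 < lam ^- k by rewrite invr_gt0.
have th1 : lam ^- k < 1 by rewrite invf_lt1.
have [r Hr] := sublinear_recursion th0 th1 (part_sum_recursion fd k0 q1) d0.
exists (Num.max r 1) => n; rewrite ge_max => /andP[/Hr h n1].
have n0 : 0 < n%:R :> R by exact: lt_le_trans ltr01 n1.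
have E : dir b G * lam ^- k / (1 - lam ^- k) = dir b ((lam ^+ k - 1)^-1 * G).
  have : lam ^+ k - 1 != 0 by rewrite gt_eqF // subr_gt0.
  have : lam ^+ k != 0 by rewrite gt_eqF.
  by move: (lam ^+ k) => L Ln0 L1n0; case: (b) => /=; field; rewrite Ln0 L1n0.
rewrite -/G E -ler_pdivrMr // in h.
have -> : dir b (Lq_val q n) = - (dir b (ln (part_sum m q n)) / n%:R).
  by rewrite /Lq_val; case: (b) => /=; rewrite ?mulNr ?opprK mulrC // mulNr.
have -> : dir b ((lam ^+ k - 1)^-1 * phi_wt k q) = - dir b ((lam ^+ k - 1)^-1 * G).
  by rewrite /phi_wt -/G mulrN; case: (b).
by rewrite -opprD lerN2.
Qed.

Lemma Lq_val_upper b q k d : rle b q 1 -> 0 <= q -> (0 < k)%N -> 0 < d ->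
  exists r : R, forall n, r <= n%:R ->
    dir b (Lq_val q n) <= dir b (lam ^- k * phi_wt k q) + d.
Proof.
move=> q1 q0 k0 d0; set G := \sum_c wt c * ln (infl_sum th k q [:: c]).
have [r Hr] := part_sum_jensen fd k0 q1 q0 d0.
exists (Num.max r 1) => n; rewrite ge_max => /andP[/Hr h n1].
have n0 : 0 < n%:R :> R by exact: lt_le_trans ltr01 n1.
have -> : dir b (Lq_val q n) = - (dir b (ln (part_sum m q n)) / n%:R).
  by rewrite /Lq_val; case: (b) => /=; rewrite ?mulNr ?opprK mulrC // mulNr.
have -> : dir b (lam ^- k * phi_wt k q) = - dir b (G * lam ^- k).
  by rewrite /phi_wt -/G mulrN mulrC; case: (b).
rewrite lerNl opprD opprK ler_pdivlMr // mulrBl (le_trans _ h) // -/G.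
by rewrite le_eqVlt; apply/orP; left; apply/eqP; case: (b) => /=; ring.
Qed.

(** The sandwich with X_k = lam^-k phi_k up to sign, for which X_k / (1 - lam^-k) is phi_k / (lam^k
    - 1). *)
Lemma Lq_val_limit b q : rle b q 1 -> 0 <= q ->
  exists l, [/\ Lq_val q n @[n --> \oo] --> l,
    lam ^- k * phi_wt k q @[k --> \oo] --> l,
    (forall k, (0 < k)%N -> rle b ((lam ^+ k - 1)^-1 * phi_wt k q) l /\
                            rle b l (lam ^- k * phi_wt k q)) &
    forall i j, (i <= j)%N ->
      rle b (lam ^- j * phi_wt j q) (lam ^- i * phi_wt i q)].
Proof.
move=> q1 q0.
have mono i j : (i <= j)%N -> rle b (lam ^- j * phi_wt j q) (lam ^- i * phi_wt i q).
  by move=> ij; rewrite -(subnK ij); exact: phi_wt_decr.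
have th0 : 0 < lam^-1 by rewrite invr_gt0.
have th1 : lam^-1 < 1 by rewrite invf_lt1 // (fd_lam_gt1 fd).
have E k : (0 < k)%N -> dir b (lam ^- k * phi_wt k q) / (1 - lam^-1 ^+ k) =
    dir b ((lam ^+ k - 1)^-1 * phi_wt k q).
  move=> k0; have L1 : 1 < lam ^+ k by rewrite exprn_egt1 ?(fd_lam_gt1 fd) // -lt0n.
  have : lam ^+ k - 1 != 0 by rewrite gt_eqF // subr_gt0.
  have : lam ^+ k != 0 by rewrite gt_eqF // (lt_trans ltr01).
  rewrite exprVn; move: (lam ^+ k) => L Ln0 L1n0.
  by case: (b) => /=; field; rewrite Ln0 L1n0.
have [k|k d k0 d0|l [Tl Xl bnd]] := @sandwich_limit R
    (fun k => dir b (lam ^- k * phi_wt k q)) (fun n => dir b (Lq_val q n)) _ th0 th1.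
- by rewrite -rle_dir; exact: mono.
- have [r1 H1] := Lq_val_lower q1 k0 d0; have [r2 H2] := Lq_val_upper q1 q0 k0 d0.
  exists (Num.max r1 r2) => n; rewrite ge_max => /andP[/H1 h1 /H2 h2].
  by rewrite E // h1 h2.
exists (dir b l); split=> //.
- exact: cvg_dir Tl.
- exact: cvg_dir Xl.
move=> k k0; have := bnd k k0; rewrite E // => /andP[h1 h2].
by rewrite !rle_dir; case: (b) h1 h2 => /= h1 h2; rewrite ?opprK.
Qed.

End spectra.

(** * The frequency measure *)

(** Transfers the bound > 1 from the eigenvalue provided by [primitive] to the given [lam]. *)
Lemma perron_eigenvalue_le (R : realType) (n : nat) (M : 'M[R]_n) (lam lam' : R) :
  perron_eigenvalue M lam -> perron_eigenvalue M lam' -> lam' <= lam.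
Proof.
move=> [_ bound] [ev _]; apply: le_trans (ler_norm lam') _.
have := bound (real_complex R lam'); rewrite eigenvalue_map => /(_ ev).
by rewrite /= expr0n addr0 sqrtr_sqr.
Qed.

Section assembly.
Context {R : realType} {A : alphabetType} {th : random_substitution R A}.
Context {lam : R} {r : 'cV[R]_#|A|} {mu : probability (borel_biseq A) R}.
Context (th_prim : primitive th) (th_comp : compatible th).
Context (lamP : perron_eigenvalue (subst_matrix th) lam).
Context (rP : perron_vector (subst_matrix th) lam r).
Context (muP : frequency_measure th mu).

Local Notation infl := (infl th).

Let wt (a : A) : R := r (enum_rank a) 0.

Let mass (v : seq A) : R :=
  if `[< legal th v >] then fine (mu (cylinder th v)) else 0.

Let ratio (v : seq A) (a : A) (k : nat) : R :=
  mean_occ th k [:: a] v / (size (infl k [:: a]))%:R.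

Let ratio_cvg v a : legal th v -> (ratio v a k)%:E @[k --> \oo] --> mu (cylinder th v).
Proof.
move=> lv; have [_ _ /(_ v a lv)] := muP.
rewrite (_ : (fun k => _) = (fun k => (ratio v a k)%:E)) //; apply/funext => k.
by rewrite mean_occE // iter_expect_size.
Qed.

(** Read off from the defining limit, whose ratios are at most 1. *)
Let mu_cylinder_fin v : legal th v -> mu (cylinder th v) \is a fin_num.
Proof.
move=> lv; have a : A := point.
have lim := cvg_lim (@ereal_hausdorff R) (@ratio_cvg v a lv).
have le1 : (mu (cylinder th v) <= 1)%E.
  rewrite -lim; apply: lime_le.
    by apply/cvg_ex; exists (mu (cylinder th v)); exact: ratio_cvg.
  near=> k; rewrite lee_fin /ratio ler_pdivrMr ?mul1r ?mean_occ_le //.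
  by rewrite ltr0n infl1_gt0.
by rewrite ge0_fin_numE ?measure_ge0 // (le_lt_trans le1) // ltry.
Unshelve. all: by end_near. Qed.

Lemma subst_matrixE b a :
  subst_matrix th b a = (count_mem (enum_val b) (rep_word th (enum_val a)))%:R.
Proof. by rewrite mxE mean_occE // mean_occ_letter //= rep_image1. Qed.

Lemma frequency_dataP : frequency_data th lam wt mass.
Proof.
have [Mr r_gt0 r_sum] := rP; split=> //.
- have [_ [lam' lam'P lam'1]] := th_prim.
  exact: lt_le_trans lam'1 (perron_eigenvalue_le lamP lam'P).
- by move=> c; exact: r_gt0.
- rewrite -r_sum (reindex (@enum_rank A)) //=.
  by exists enum_val => x _; rewrite ?enum_rankK ?enum_valK.
(* After exchanging the sums, the coefficient of G(c) is row c of M r = lam r. *)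
- move=> G; under eq_bigr do rewrite count_sum mulr_sumr.
  rewrite exchange_big mulr_sumr; apply: eq_bigr => c _ /=.
  under eq_bigr do rewrite mulrA.
  rewrite -mulr_suml mulrA; congr (_ * _).
  have := congr1 (fun x : 'cV_ _ => x (enum_rank c) 0) Mr; rewrite !mxE => <-.
  rewrite (reindex (@enum_rank A)) /=; last first.
    by exists enum_val => x _; rewrite ?enum_rankK ?enum_valK.
  by apply: eq_bigr => a _; rewrite subst_matrixE !enum_rankK mulrC.
- move=> v a lv; rewrite /mass asboolT //.
  apply: (fine_cvg (f := fun k => (ratio v a k)%:E)).
  by rewrite fineK ?mu_cylinder_fin //; exact: ratio_cvg.
- by move=> v nl; rewrite /mass asboolF.
Qed.

(** Legal words have positive mass by [m_gt0], so [pw] and the real power agree on them. *)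
Lemma Lq_termE q n : Lq_term th mu q n = (Lq_val (m := mass) q n)%:E.
Proof.
rewrite /Lq_term /Lq_val; congr (_ * ln _)%:E.
rewrite (big_tuple_words n (fun u => `[< legal th u >])
  (fun u => fine (mu (cylinder th u)) `^ q)) /part_sum big_mkcond.
apply: eq_bigr => u _; rewrite /mass; case: asboolP => [lu|_]; last by rewrite pw0.
have := m_gt0 frequency_dataP lu; rewrite /mass asboolT // => mu0.
by rewrite /pw gt_eqF.
Qed.

Lemma phiE k q : phi th r k q = phi_wt (th := th) (wt := wt) k q.
Proof.
rewrite /phi /phi_wt; congr (- _); apply: eq_bigr => a _; congr (_ * ln _).
rewrite fsum_iter_words // big_mkcond; apply: eq_bigr => s _.
by rewrite /pw; case: eqVneq.
Qed.

End assembly.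

Lemma cvg_EFinR (R : realType) (f : nat -> R) (l : R) :
  f n @[n --> \oo] --> l -> (f n)%:E @[n --> \oo] --> l%:E.
Proof. by move=> fl; apply: cvg_EFin => //; exact: nearW. Qed.

Theorem theoremA (R : realType) (A : alphabetType)
    (th : random_substitution R A) (lam : R) (r : 'cV[R]_#|A|)
    (mu : probability (borel_biseq A) R) :
  primitive th -> compatible th ->
  perron_eigenvalue (subst_matrix th) lam ->
  perron_vector (subst_matrix th) lam r ->
  frequency_measure th mu ->
  let tau := Lq_spectrum th mu in
  let phi_ := phi th r in
  [/\ forall q : R, 0 <= q ->
        [/\ Lq_term th mu q @ \oo --> tau q,
            inflation_term th lam r q @ \oo --> inflation_spectrum th lam r q &
            tau q = inflation_spectrum th lam r q],
      forall q : R, 0 <= q <= 1 ->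
        [/\ forall k : nat, (0 < k)%N ->
              (((lam ^+ k - 1)^-1 * phi_ k q)%:E <= tau q
                <= (lam ^- k * phi_ k q)%:E)%E,
            nonincreasing_seq (fun k => lam ^- k.+1 * phi_ k.+1 q) &
            (lam ^- k.+1 * phi_ k.+1 q)%:E @[k --> \oo] --> tau q],
      forall q : R, 1 <= q ->
        [/\ forall k : nat, (0 < k)%N ->
              ((lam ^- k * phi_ k q)%:E <= tau q
                <= ((lam ^+ k - 1)^-1 * phi_ k q)%:E)%E,
            nondecreasing_seq (fun k => lam ^- k.+1 * phi_ k.+1 q) &
            (lam ^- k.+1 * phi_ k.+1 q)%:E @[k --> \oo] --> tau q] &
      forall q : R, q < 0 -> forall k : nat, (0 < k)%N ->
        (((lam ^+ k - 1)^-1 * phi_ k q)%:E <= tau q)%E].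
Proof.
move=> th_prim th_comp lamP rP muP tau phi_.
have fd := frequency_dataP th_prim th_comp lamP rP muP.
have phi_E k q : phi_ k q = phi_wt (th := th) (wt := fun a => r (enum_rank a) 0) k q.
  exact: phiE.
pose t q n := Lq_val (m := fun v => if `[< legal th v >] then
  fine (mu (cylinder th v)) else 0) q n.
have tE q : Lq_term th mu q = (fun n => (t q n)%:E).
  by apply/funext => n; exact: Lq_termE th_prim th_comp lamP rP muP q n.
have infl_termE q : inflation_term th lam r q =
    (fun k => (lam ^- k * phi_wt (th := th) (wt := fun a => r (enum_rank a) 0) k q)%:E).
  by apply/funext => k; rewrite /inflation_term -phi_E.
have limits b q : rle b q 1 -> 0 <= q -> exists l,
   [/\ tau q = l%:E /\ inflation_spectrum th lam r q = l%:E,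
     t q n @[n --> \oo] --> l,
     lam ^- k * phi_ k q @[k --> \oo] --> l,
     (forall k, (0 < k)%N -> rle b ((lam ^+ k - 1)^-1 * phi_ k q) l /\
                             rle b l (lam ^- k * phi_ k q)) &
     forall i j, (i <= j)%N -> rle b (lam ^- j * phi_ j q) (lam ^- i * phi_ i q)].
  move=> q1 q0; have [l [tl pl bnd mono]] := Lq_val_limit fd q1 q0.
  exists l; split.
  - rewrite /tau /Lq_spectrum /inflation_spectrum tE infl_termE.
    by rewrite (cvg_limn_einf_sup (cvg_EFinR tl)).1
      (cvg_limn_einf_sup (cvg_EFinR pl)).1.
  - exact: tl.
  - by under eq_fun do rewrite phi_E.
  - by move=> k; rewrite phi_E; exact: bnd.
  - by move=> i j; rewrite !phi_E; exact: mono.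
split=> [q q0|q /andP[q0 q1]|q q1|q q_neg k k0].
- have [b q1] : exists b, rle b q 1.
    by case: (leP q 1) => q1; [exists true|exists false; exact: ltW].
  have [l [[-> ->] tl pl _ _]] := limits b q q1 q0; split=> //.
    by rewrite tE; exact: cvg_EFinR tl.
  exact: cvg_EFinR pl.
- have [l [[-> _] tl pl bnd mono]] := limits true q q1 q0; split.
  + by move=> k k0; rewrite !lee_fin; have [h1 h2] := bnd k k0; exact/andP.
  + by move=> i j ij; exact: mono.
  + by apply: cvg_EFinR; move: pl; rewrite -cvg_shiftS.
- have [l [[-> _] tl pl bnd mono]] := limits false q q1 (le_trans ler01 q1); split.
  + by move=> k k0; rewrite !lee_fin; have [h1 h2] := bnd k k0; exact/andP.
  + by move=> i j ij; exact: mono.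
  + by apply: cvg_EFinR; move: pl; rewrite -cvg_shiftS.
(* A negative q falls under the case q <= 1 of the lower bound, which rests on subadditivity
   alone. *)
- rewrite /tau /Lq_spectrum tE phi_E; apply: limn_einf_ge => d d0.
  have q1 : rle true q 1 by exact: le_trans (ltW q_neg) ler01.
  by have [x Hx] := Lq_val_lower fd q1 k0 d0; exists x => n /Hx.
Qed.
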